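(* Let $n \geq 1$ and let $L$ be a Lie subalgebra of $\mathbb{W}_n$ with $\mathrm{GKdim}(L) = n$. Then $U(L)$ is not noetherian.
   Context: $\Bbbk$ is a field of characteristic zero. $\mathbb{W}_n = \mathrm{Der}(\Bbbk[x_1,\dots,x_n]) = \sum_{i=1}^n \Bbbk[x_1,\dots,x_n]\partial_i$ with $\partial_i = \partial/\partial x_i$. $\mathrm{GKdim}$ denotes the Gelfand--Kirillov dimension of a Lie algebra (the supremum over finitely generated subalgebras $L'$, generated by a finite-dimensional subspace $V$, of the growth rate $\limsup_k \log\dim(V + C_1(V)+\dots+C_k(V))/\log k$, where $C_0(V)=V$ and $C_k(V) = [C_{k-1}(V),V]$). Noetherian means left and right noetherian. *)

(* Defs.v *)
From mathcomp Require Import all_boot all_algebra.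
From mathcomp Require Import monalg mpoly.
From mathcomp Require Import all_classical all_reals all_analysis.

Set Implicit Arguments.
Unset Strict Implicit.
Unset Printing Implicit Defensive.

Import GRing.Theory Num.Theory.
Local Open Scope ring_scope.
Local Open Scope classical_set_scope.

Definition span (k : fieldType) (V : lmodType k) (A : set V) : set V :=
  [set v | exists (m : nat) (c : 'I_m -> k) (x : 'I_m -> V),
             (forall i, A (x i)) /\ v = \sum_(i < m) c i *: x i].

Definition lin_indep (k : fieldType) (V : lmodType k) (s : seq V) : Prop :=
  forall c : 'I_(size s) -> k,
    \sum_(i < size s) c i *: s`_i = 0 -> forall i, c i = 0.

Definition dimE (R : realType) (k : fieldType) (V : lmodType k) (S : set V)
  : \bar R :=
  ereal_sup [set ((size s)%:R)%:E | s in
               [set s : seq V | (forall x, x \in s -> S x) /\ lin_indep s]].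

Fixpoint Cspace (k : fieldType) (V : lmodType k) (br : V -> V -> V)
    (vs : seq V) (j : nat) : set V :=
  match j with
  | 0 => span [set x | x \in vs]
  | j'.+1 => span [set br x y | x in Cspace br vs j' & y in span [set x | x \in vs]]
  end.

Definition Gspace (k : fieldType) (V : lmodType k) (br : V -> V -> V)
    (vs : seq V) (j : nat) : set V :=
  span [set x | exists i, (i <= j)%N /\ Cspace br vs i x].

Definition growth_ratio (R : realType) (k : fieldType) (V : lmodType k)
    (br : V -> V -> V) (vs : seq V) (j : nat) : R :=
  ln (fine (dimE R (Gspace br vs j))) / ln (j%:R).

Definition growth_rate (R : realType) (k : fieldType) (V : lmodType k)
    (br : V -> V -> V) (vs : seq V) : \bar R :=
  limn_esup (fun j => (growth_ratio R br vs j)%:E).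

(* GKdim(L) = sup over finite-dimensional subspaces V0 = span vs of L
   (each generating a finitely generated subalgebra L') of the growth
   rate. *)
Definition GKdim (R : realType) (k : fieldType) (V : lmodType k)
    (br : V -> V -> V) (L : set V) : \bar R :=
  ereal_sup [set growth_rate R br vs | vs in
               [set vs : seq V | forall x, x \in vs -> L x]].

(* The Witt algebra W_n = Der(k[x_1..x_n]) = sum_i k[x]d_i.            *)
(* An element X = sum_i f_i d_i is represented by (f_i)_i.             *)

Definition Witt (k : fieldType) (n : nat) := {ffun 'I_n -> mpoly.mpoly n k}.

(* [sum_i f_i d_i, sum_j g_j d_j] = sum_j (sum_i f_i d_i g_j - g_i d_i f_j) d_j *)
Definition wbracket (k : fieldType) (n : nat) (X Y : Witt k n) : Witt k n :=
  [ffun j => \sum_(i < n) (X i * mpoly.mderiv i (Y j)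
                           - Y i * mpoly.mderiv i (X j))].

Definition is_Lie_subalgebra (k : fieldType) (n : nat) (L : {pred Witt k n})
  : Prop :=
  [/\ 0 \in L,
      forall x y, x \in L -> y \in L -> x + y \in L,
      forall (a : k) x, x \in L -> a *: x \in L
    & forall x y, x \in L -> y \in L -> wbracket x y \in L].

(* Universal enveloping algebra U(L) = k<L> / J, where k<L> is the free *)
(* associative algebra on the set L and J is the two-sided ideal        *)
(* generated by  z - (a x + y)  (z = a x + y in L)  and                 *)
(* x y - y x - z  (z = [x,y] in L).  (k<L>/(linearity relations) is the *)
(* tensor algebra T(L).)                                                *)

Definition Lelt (k : fieldType) (n : nat) (L : {pred Witt k n}) :=
  {x : Witt k n | x \in L}.

Definition freeAlg (k : fieldType) (n : nat) (L : {pred Witt k n}) :=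
  monalg.malg (monalg.fmonom (Lelt L)) k.

Definition letter (k : fieldType) (n : nat) (L : {pred Witt k n}) (x : Lelt L)
  : freeAlg L :=
  monalg.mkmalgU (monalg.fmu x) 1.

Definition UL_relations (k : fieldType) (n : nat) (L : {pred Witt k n})
  : set (freeAlg L) :=
  [set r | (exists (a : k) (x y z : Lelt L),
              val z = a *: val x + val y /\
              r = letter z - (a *: letter x + letter y))
        \/ (exists x y z : Lelt L,
              val z = wbracket (val x) (val y) /\
              r = letter x * letter y - letter y * letter x - letter z)].

Definition UL_ideal (k : fieldType) (n : nat) (L : {pred Witt k n})
  : set (freeAlg L) :=
  span [set v | exists (a r b : freeAlg L), @UL_relations _ _ L r /\ v = a * r * b].

(* Noetherianity of a quotient ring A/J, stated through the (standard)  *)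
(* correspondence between left (resp. right) ideals of A/J and left     *)
(* (resp. right) ideals of A containing J.                              *)

Definition left_ideal (A : pzRingType) (I : set A) : Prop :=
  [/\ I 0, forall x y, I x -> I y -> I (x + y) & forall a x, I x -> I (a * x)].

Definition right_ideal (A : pzRingType) (I : set A) : Prop :=
  [/\ I 0, forall x y, I x -> I y -> I (x + y) & forall a x, I x -> I (x * a)].

Definition quot_left_noetherian (A : pzRingType) (J : set A) : Prop :=
  forall I : nat -> set A,
    (forall m, left_ideal (I m) /\ J `<=` I m /\ I m `<=` I m.+1) ->
    exists N, forall m, (N <= m)%N -> I m = I N.

Definition quot_right_noetherian (A : pzRingType) (J : set A) : Prop :=
  forall I : nat -> set A,
    (forall m, right_ideal (I m) /\ J `<=` I m /\ I m `<=` I m.+1) ->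
    exists N, forall m, (N <= m)%N -> I m = I N.

Definition quot_noetherian (A : pzRingType) (J : set A) : Prop :=
  quot_left_noetherian J /\ quot_right_noetherian J.

Definition UL_noetherian (k : fieldType) (n : nat) (L : {pred Witt k n})
  : Prop := quot_noetherian (@UL_ideal _ _ L).

(* Main.v *)
(** Elements of S^2(L) are regarded as bivector-valued functions X^{ij}(x,y) of two points and are
filtered by their order r of vanishing on the diagonal x = y.  As quadratic elements of U(L) they
act on the bivectors with one leg at x and the other at y.  The bivector
v^{ij} = (y_i - x_i)(y_j - x_j) is L-invariant modulo order three; an element of S^2(L) of large
order r sends order three into order r + 1, and sends v to the image of its own leading term under
an injective linear map.  Hence the elements whose leading term of order r lies in a given
subspace come from a right ideal of U(L), and if U(L) is right noetherian the space of leading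
terms of order r is finite dimensional for every large r.

If L is infinite dimensional, some nonzero Z in L therefore kills all these leading terms up to
any prescribed order.  Choose p with Z x_p <> 0: applying Z repeatedly shows that a relation
sum_e x_p^e u_e = 0 with all u_e in S^2(L) of large order forces every u_e to vanish.  If the part
of degree at most d of L has dimension l, this bounds d l^2 by the dimension O(d^(2n)) of the
bivectors of degree O(d), so l^2 = O(d^(2n-1)) and GKdim L <= n - 1/2 < n. *)

From HB Require Import structures.
Require Import Defs.
From mathcomp Require Import all_boot all_order all_algebra finmap.
From mathcomp Require Import monalg.
From mathcomp Require Import boolp ring lra zify.

Set Implicit Arguments.
Unset Strict Implicit.
Unset Printing Implicit Defensive.

Import Order.TTheory GRing.Theory Num.Theory.
Local Open Scope ring_scope.

(** * Lie derivatives *)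

Lemma eq_dsum_antisym (V : zmodType) (n : nat) (F G H : 'I_n -> 'I_n -> V) :
  (forall a b, F a b - G a b = H a b - H b a) ->
  \sum_a \sum_b F a b = \sum_a \sum_b G a b.
Proof.
move=> h; apply/eqP; rewrite -subr_eq0 -sumrB.
under eq_bigr do (rewrite -sumrB; under eq_bigr do rewrite h).
under eq_bigr do rewrite sumrB.
by rewrite sumrB [X in _ - X]exchange_big subrr.
Qed.

Section LieDerivative.
Variables (P : comNzRingType) (n : nat) (d : 'I_n -> {additive P -> P}).
Hypothesis dM : forall i f g, d i (f * g) = d i f * g + f * d i g.
Hypothesis dC : forall i j f, d i (d j f) = d j (d i f).

Definition lieD (X g : 'I_n -> P) (i : 'I_n) : P :=
  \sum_a (X a * d a (g i) - g a * d a (X i)).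

Lemma lieD_lieD X Y g i : lieD X (lieD Y g) i = \sum_a \sum_b
  (X a * d a (Y b) * d b (g i) + X a * Y b * d a (d b (g i))
   - X a * d b (Y i) * d a (g b) - X a * d a (d b (Y i)) * g b
   - Y b * d a (X i) * d b (g a) + d a (X i) * d b (Y a) * g b).
Proof.
apply: eq_bigr => a _; rewrite /lieD raddf_sum mulr_sumr mulr_suml -sumrB.
by apply: eq_bigr => b _ /=; rewrite raddfB /= !dM; ring.
Qed.

Lemma lieD_jacobi X Y g i :
  lieD X (lieD Y g) i - lieD Y (lieD X g) i = lieD (lieD X Y) g i.
Proof.
rewrite !lieD_lieD -sumrB; under eq_bigr do rewrite -sumrB.
have -> : lieD (lieD X Y) g i = \sum_a \sum_b
   ((X b * d b (Y a) - Y b * d b (X a)) * d a (g i)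
    - g a * (d a (X b) * d b (Y i) + X b * d a (d b (Y i))
             - d a (Y b) * d b (X i) - Y b * d a (d b (X i)))).
  apply: eq_bigr => a _; rewrite /lieD raddf_sum mulr_sumr mulr_suml -sumrB.
  by apply: eq_bigr => b _ /=; rewrite raddfB /= !dM; ring.
apply: (eq_dsum_antisym (H := fun a b =>
  X a * d a (Y b) * d b (g i) + X a * Y b * d a (d b (g i)) - X a * d a (g b) * d b (Y i)
  - X a * g b * d a (d b (Y i)) + g b * d b (Y a) * d a (X i) - Y a * d a (X b) * d b (g i)
  + Y a * d a (g b) * d b (X i) + Y a * g b * d a (d b (X i)) - g b * d b (X a) * d a (Y i)))
  => a b.
rewrite (dC b a (g i)) (dC b a (Y i)) (dC b a (X i)); ring.
Qed.

Lemma eq_lieD X X' g g' i : X =1 X' -> g =1 g' -> lieD X g i = lieD X' g' i.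
Proof. by move=> eX eg; apply: eq_bigr => a _; rewrite !eX !eg. Qed.

End LieDerivative.

(** * Functions of two points *)

(* [tpA] stands for the functions of a point and [tpP] for the functions of a pair of points
   [(x, y)]; [inx] and [iny] are the pullbacks along the two projections, [diag] is the restriction
   to the diagonal. *)
Record two_point (k : fieldType) (n : nat) := TwoPoint {
  tpA : comAlgType k;
  tpP : comAlgType k;
  pd : 'I_n -> {linear tpA -> tpA};
  dx : 'I_n -> {linear tpP -> tpP};
  dy : 'I_n -> {linear tpP -> tpP};
  inx : {lrmorphism tpA -> tpP};
  iny : {lrmorphism tpA -> tpP};
  diag : {lrmorphism tpP -> tpA};
  coord : 'I_n -> tpA;
  tpA_domain : forall a b : tpA, a * b = 0 -> a = 0 \/ b = 0;
  pdM : forall i f g, pd i (f * g) = pd i f * g + f * pd i g;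
  pdX : forall i j, pd i (coord j) = (i == j)%:R;
  dxM : forall i f g, dx i (f * g) = dx i f * g + f * dx i g;
  dyM : forall i f g, dy i (f * g) = dy i f * g + f * dy i g;
  dxC : forall i j f, dx i (dx j f) = dx j (dx i f);
  dyC : forall i j f, dy i (dy j f) = dy j (dy i f);
  dxyC : forall i j f, dx i (dy j f) = dy j (dx i f);
  dx_inx : forall i f, dx i (inx f) = inx (pd i f);
  dy_iny : forall i f, dy i (iny f) = iny (pd i f);
  dx_iny : forall i f, dx i (iny f) = 0;
  dy_inx : forall i f, dy i (inx f) = 0;
  diag_inx : cancel inx diag;
  diag_iny : cancel iny diag;
  diag_dxdy : forall i g, diag (dx i g + dy i g) = pd i (diag g)
}.

Arguments pd {k n D} i : rename.
Arguments dx {k n D} i : rename.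
Arguments dy {k n D} i : rename.
Arguments inx {k n D} : rename.
Arguments iny {k n D} : rename.
Arguments diag {k n D} : rename.
Arguments coord {k n D} i : rename.

Section Vanishing.
Variables (k : fieldType) (n : nat) (D : two_point k n).
Local Notation A := (tpA D).
Local Notation P := (tpP D).

Fixpoint vanish (r : nat) (g : P) : Prop :=
  match r with
  | 0 => True
  | r'.+1 => diag g = 0 /\ forall i, vanish r' (dy i g)
  end.

Lemma vanish_diag r g : vanish r.+1 g -> diag g = 0.
Proof. by case. Qed.

Lemma vanish_dy r g i : vanish r.+1 g -> vanish r (dy i g).
Proof. by case=> _; apply. Qed.

Lemma vanish0 r : vanish r 0.
Proof. by elim: r => //= r IH; split=> [|i]; rewrite raddf0. Qed.

Lemma vanishD r g h : vanish r g -> vanish r h -> vanish r (g + h).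
Proof.
elim: r g h => [//|r IH] g h [g0 dg] [h0 dh].
split; first by rewrite raddfD /= g0 h0 addr0.
by move=> i; rewrite raddfD /=; apply: IH; [apply: dg | apply: dh].
Qed.

Lemma vanishS r g : vanish r.+1 g -> vanish r g.
Proof. by elim: r g => [//|r IH] g [g0 dg]; split=> // i; apply: IH; apply: dg. Qed.

Lemma vanish_le r s g : (s <= r)%N -> vanish r g -> vanish s g.
Proof.
by move=> /subnK <-; elim: (r - s)%N => // d IH; rewrite addSn => /vanishS.
Qed.

Lemma vanish_mull s g h : vanish s h -> vanish s (g * h).
Proof.
elim: s g h => [//|s IH] g h vh; split; first by rewrite rmorphM /= (vanish_diag vh) mulr0.
move=> i; rewrite dyM; apply: vanishD; apply: IH; last exact: vanish_dy.
exact: vanishS.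
Qed.

Lemma vanishM r s g h : vanish r g -> vanish s h -> vanish (r + s) (g * h).
Proof.
elim: {r s}(r + s)%N {-2}r {-2}s (leqnn (r + s)) g h => [|t IH] r s.
  by rewrite leqn0 addn_eq0 => /andP[/eqP -> /eqP ->].
case: r => [|r]; first by move=> _ g h _; apply: vanish_mull.
case: s => [|s] le_t g h vg vh.
  by rewrite addn0 mulrC; apply: vanish_mull.
rewrite addSn; split; first by rewrite rmorphM /= (vanish_diag vg) mul0r.
move=> i; rewrite dyM; apply: vanishD; first by apply: IH vh => //; apply: vanish_dy.
by rewrite addnS -addSn; apply: IH vg _; [rewrite addSnnS | apply: vanish_dy].
Qed.

Lemma vanishZ r (a : k) g : vanish r g -> vanish r (a *: g).
Proof. by move=> vg; rewrite -[g]mul1r scalerAl; apply: vanish_mull. Qed.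

Lemma vanishN r g : vanish r g -> vanish r (- g).
Proof. by rewrite -scaleN1r; apply: vanishZ. Qed.

Lemma vanishB r g h : vanish r g -> vanish r h -> vanish r (g - h).
Proof. by move=> vg vh; apply: vanishD => //; apply: vanishN. Qed.

Lemma vanish_sum r I (s : seq I) (Q : pred I) (F : I -> P) :
  (forall i, Q i -> vanish r (F i)) -> vanish r (\sum_(i <- s | Q i) F i).
Proof. by move=> vF; apply: big_ind => //; [apply: vanish0 | apply: vanishD]. Qed.

Lemma vanish_dxdy r g i : vanish r g -> vanish r (dx i g + dy i g).
Proof.
elim: r g => [//|r IH] g vg; split; first by rewrite diag_dxdy (vanish_diag vg) raddf0.
by move=> j; rewrite raddfD /= -dxyC dyC; apply: IH; apply: vanish_dy.
Qed.

Lemma vanish_dx r g i : vanish r.+1 g -> vanish r (dx i g).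
Proof.
move=> vg; rewrite -[dx i g](addrK (dy i g)); apply: vanishB; last exact: vanish_dy.
by apply: vanish_dxdy; apply: vanishS.
Qed.

Lemma vanish_inx_cancel r p g : p != 0 -> vanish r (inx p * g) -> vanish r g.
Proof.
move=> p0; elim: r g => [//|r IH] g vg; split.
  have := vanish_diag vg; rewrite rmorphM /= diag_inx => /tpA_domain[] // p_eq0.
  by rewrite p_eq0 eqxx in p0.
by move=> i; apply: IH; have := vanish_dy i vg; rewrite dyM dy_inx mul0r add0r.
Qed.

Lemma vanish_natr_cancel r (e : nat) g :
  (e%:R != 0 :> k) -> vanish r (g *+ e) -> vanish r g.
Proof.
move=> e0 vg; rewrite -[g]scale1r -(mulVf e0) -scalerA scaler_nat.
exact: vanishZ.
Qed.

Definition zvar i : P := iny (coord i) - inx (coord i).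

Lemma dx_zvar i j : dx i (zvar j) = - (i == j)%:R.
Proof. by rewrite raddfB /= dx_iny dx_inx pdX rmorph_nat /= sub0r. Qed.

Lemma dy_zvar i j : dy i (zvar j) = (i == j)%:R.
Proof. by rewrite raddfB /= dy_iny dy_inx pdX rmorph_nat /= subr0. Qed.

Lemma vanish_iny_inx p : vanish 1 (iny p - inx p).
Proof. by split => //; rewrite raddfB /= diag_inx diag_iny subrr. Qed.

Lemma vanish_zvar i : vanish 1 (zvar i).
Proof. exact: vanish_iny_inx. Qed.

Lemma vanish_zvarM r g i : vanish r g -> vanish r.+1 (zvar i * g).
Proof. exact: vanishM (vanish_zvar i). Qed.

Lemma sum_delta (F : 'I_n -> P) j : \sum_i (i == j)%:R * F i = F j.
Proof.
rewrite (bigD1 j) //= eqxx mul1r big1 ?addr0 // => i /negbTE ->.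
by rewrite mul0r.
Qed.

Lemma vanish_euler r g : vanish r g ->
  vanish r.+1 (\sum_i zvar i * dy i g - g *+ r).
Proof.
elim: r g => [|r IH] g vg.
  split=> //; rewrite subr0 raddf_sum /= big1 // => i _.
  by rewrite rmorphM /= (vanish_diag (vanish_zvar i)) mul0r.
split.
  rewrite raddfB /= raddf_sum /= raddfMn /= (vanish_diag vg) mul0rn subr0 big1 // => i _.
  by rewrite rmorphM /= (vanish_diag (vanish_zvar i)) mul0r.
move=> j; have -> : dy j (\sum_i zvar i * dy i g - g *+ r.+1) =
    \sum_i zvar i * dy i (dy j g) - dy j g *+ r.
  rewrite raddfB /= raddf_sum /= raddfMn /=.
  under eq_bigr do rewrite dyM dy_zvar dyC eq_sym.
  by rewrite big_split /= sum_delta mulrS opprD addrACA subrr add0r.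
by apply: IH; apply: vanish_dy.
Qed.

End Vanishing.

Arguments vanish : simpl never.

(** * Two-point bivectors and the action of vector fields *)

Section Tensors.
Variables (k : fieldType) (n : nat) (D : two_point k n).
Local Notation A := (tpA D).
Local Notation P := (tpP D).
Local Notation W := {ffun 'I_n -> A}.
Local Notation T := {ffun 'I_n * 'I_n -> P}.
Implicit Types (X Y : W) (t u : T).

Definition wbr X Y : W := [ffun j => \sum_i (X i * pd i (Y j) - Y i * pd i (X j))].

Definition tens X Y : T := [ffun p => inx (X p.1) * iny (Y p.2)].
Definition symtens X Y : T := tens X Y + tens Y X.

Lemma symtensE X Y p :
  symtens X Y p = inx (X p.1) * iny (Y p.2) + inx (Y p.1) * iny (X p.2).
Proof. by rewrite !ffunE. Qed.

Lemma dx_inx_iny i (f g : A) : dx i (inx f * iny g) = inx (pd i f) * iny g :> P.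
Proof. by rewrite dxM dx_inx dx_iny mulr0 addr0. Qed.

Lemma dy_inx_iny i (f g : A) : dy i (inx f * iny g) = inx f * iny (pd i g) :> P.
Proof. by rewrite dyM dy_inx dy_iny mul0r add0r. Qed.

Lemma diag_inx_iny (f g : A) : diag (inx f * iny g : P) = f * g.
Proof. by rewrite rmorphM /= diag_inx diag_iny. Qed.

Section SecondOrder.
Variables (phi : {lrmorphism A -> P}) (d : 'I_n -> {linear P -> P}).
Hypothesis dM : forall i (f g : P), d i (f * g) = d i f * g + f * d i g.
Hypothesis dphi : forall i p, d i (phi p) = phi (pd i p).

Definition sec_op t (g : 'I_n -> P) (i : 'I_n) : P := \sum_a \sum_b
  (phi (diag (dy a (t (a, b)))) * d b (g i) + phi (diag (t (a, b))) * d a (d b (g i))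
   - phi (diag (dy b (t (a, i)))) * d a (g b) - phi (diag (dy a (dy b (t (a, i))))) * g b
   - phi (diag (dy a (t (b, i)))) * d b (g a)
   + phi (diag (dx b (dy a (t (a, i))))) * g b).

Lemma sec_opD t u g i : sec_op (t + u) g i = sec_op t g i + sec_op u g i.
Proof.
rewrite /sec_op -big_split; apply: eq_bigr => a _ /=.
rewrite -big_split; apply: eq_bigr => b _ /=.
by rewrite !ffunE !raddfD /=; ring.
Qed.

Lemma sec_op0 t g i : (forall p, vanish 3 (t p)) -> sec_op t g i = 0.
Proof.
move=> vt; rewrite /sec_op big1 // => a _; rewrite big1 // => b _.
have v1 p c : diag (dy c (t p)) = 0.
  by apply: (@vanish_diag _ _ _ 1); apply: vanish_dy; apply: vt.
have v2 p c e : diag (dy c (dy e (t p))) = 0.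
  by apply: (@vanish_diag _ _ _ 0); do 2!apply: vanish_dy; apply: vt.
have v3 p c e : diag (dx c (dy e (t p))) = 0.
  by apply: (@vanish_diag _ _ _ 0); apply: vanish_dx; apply: vanish_dy; apply: vt.
by rewrite !v1 v2 v3 (vanish_diag (vt _)) !rmorph0 !mul0r !subr0 !addr0.
Qed.

Lemma lieD_sym_sec_op X Y g i :
  lieD d (phi \o X) (lieD d (phi \o Y) g) i + lieD d (phi \o Y) (lieD d (phi \o X) g) i
  = sec_op (symtens X Y) g i.
Proof.
rewrite !lieD_lieD // -big_split; apply: eq_bigr => a _ /=.
rewrite -big_split; apply: eq_bigr => b _ /=.
have D1 c p : diag (dy c (symtens X Y p)) = X p.1 * pd c (Y p.2) + Y p.1 * pd c (X p.2).
  by rewrite symtensE !raddfD /= !dy_inx_iny !diag_inx_iny.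
have D2 c e p : diag (dy c (dy e (symtens X Y p))) =
    X p.1 * pd c (pd e (Y p.2)) + Y p.1 * pd c (pd e (X p.2)).
  by rewrite symtensE !raddfD /= !dy_inx_iny !diag_inx_iny.
have D3 c e p : diag (dx c (dy e (symtens X Y p))) =
    pd c (X p.1) * pd e (Y p.2) + pd c (Y p.1) * pd e (X p.2).
  by rewrite symtensE !raddfD /= !dy_inx_iny !dx_inx_iny !diag_inx_iny.
rewrite !D1 D2 D3 symtensE !raddfD /= !diag_inx_iny !rmorphM /=.
by rewrite !dphi; ring.
Qed.

End SecondOrder.

Implicit Types g h : T.

Definition lam_x X g : T := [ffun p => lieD dx (inx \o X) (fun a => g (a, p.2)) p.1].
Definition lam_y X g : T := [ffun p => lieD dy (iny \o X) (fun b => g (p.1, b)) p.2].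
Definition rho X g : T := lam_x X g + lam_y X g.

Definition cross t g : T := [ffun p => \sum_a \sum_b
  (t (a, b) * dx a (dy b (g p)) - dy b (t (a, p.2)) * dx a (g (p.1, b))
   - dx a (t (p.1, b)) * dy b (g (a, p.2)) + dx a (dy b (t p)) * g (a, b))].

Lemma lam_xy X Y g : lam_x X (lam_y Y g) = cross (tens X Y) g.
Proof.
apply/ffunP => -[i j]; rewrite !ffunE /=; apply: eq_bigr => a _.
rewrite !ffunE /= /lieD raddf_sum mulr_sumr mulr_suml -sumrB.
apply: eq_bigr => b _; rewrite !ffunE /= raddfB /= !dy_inx_iny !dx_inx_iny !dxM.
rewrite !dy_iny !dx_iny !dx_inx; ring.
Qed.

Lemma lam_yx X Y g : lam_y Y (lam_x X g) = cross (tens X Y) g.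
Proof.
apply/ffunP => -[i j]; rewrite !ffunE /= [RHS]exchange_big; apply: eq_bigr => b _.
rewrite !ffunE /= /lieD raddf_sum mulr_sumr mulr_suml -sumrB.
apply: eq_bigr => a _; rewrite !ffunE /= raddfB /= !dy_inx_iny !dx_inx_iny !dyM.
rewrite !dx_inx !dy_inx !dy_iny dxyC; ring.
Qed.

Lemma crossDl t u g : cross (t + u) g = cross t g + cross u g.
Proof.
apply/ffunP => p; rewrite !ffunE -big_split; apply: eq_bigr => a _ /=.
rewrite -big_split; apply: eq_bigr => b _ /=.
by rewrite !ffunE !raddfD /=; ring.
Qed.

Lemma crossZl (c : k) t g : cross (c *: t) g = c *: cross t g.
Proof.
apply/ffunP => p; rewrite !ffunE scaler_sumr; apply: eq_bigr => a _ /=.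
rewrite scaler_sumr; apply: eq_bigr => b _ /=.
by rewrite !ffunE !linearZ /= !scalerDr !scalerN !scalerAl.
Qed.

Lemma lam_xD X g h : lam_x X (g + h) = lam_x X g + lam_x X h.
Proof.
apply/ffunP => p; rewrite !ffunE -big_split; apply: eq_bigr => a _ /=.
by rewrite !ffunE !raddfD /=; ring.
Qed.

Lemma lam_yD X g h : lam_y X (g + h) = lam_y X g + lam_y X h.
Proof.
apply/ffunP => p; rewrite !ffunE -big_split; apply: eq_bigr => a _ /=.
by rewrite !ffunE !raddfD /=; ring.
Qed.

Lemma rhoD X g h : rho X (g + h) = rho X g + rho X h.
Proof. by rewrite /rho lam_xD lam_yD addrACA. Qed.

Lemma rhoZ X (c : k) g : rho X (c *: g) = c *: rho X g.
Proof.
apply/ffunP => p; rewrite !ffunE scalerDr !scaler_sumr.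
by congr (_ + _); apply: eq_bigr => a _ /=;
  rewrite !ffunE !linearZ /= -scalerAr -scalerAl -scalerBr.
Qed.

Lemma rho_linear X : linear (rho X).
Proof. by move=> c g h; rewrite rhoD rhoZ. Qed.

HB.instance Definition _ X := GRing.isLinear.Build k T T *:%R (rho X) (rho_linear X).

Lemma rhoPl (c : k) X Y g : rho (c *: X + Y) g = c *: rho X g + rho Y g.
Proof.
apply/ffunP => p; rewrite !ffunE scalerDr addrACA !scaler_sumr.
congr (_ + _); rewrite -big_split; apply: eq_bigr => a _ /=.
  by rewrite !ffunE !linearP /= mulrDl mulrDr -scalerAl -scalerAr scalerBr opprD addrACA.
by rewrite !ffunE !linearP /= mulrDl mulrDr -scalerAl -scalerAr scalerBr opprD addrACA.
Qed.

Lemma lam_x_lieD X Y g i j : lam_x X (lam_x Y g) (i, j) =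
  lieD dx (inx \o X) (lieD dx (inx \o Y) (fun a => g (a, j))) i.
Proof. by rewrite ffunE; apply: eq_lieD => // a; rewrite ffunE. Qed.

Lemma lam_y_lieD X Y g i j : lam_y X (lam_y Y g) (i, j) =
  lieD dy (iny \o X) (lieD dy (iny \o Y) (fun b => g (i, b))) j.
Proof. by rewrite ffunE; apply: eq_lieD => // b; rewrite ffunE. Qed.

Lemma rho_rho X Y g : rho X (rho Y g) =
  lam_x X (lam_x Y g) + lam_y X (lam_y Y g) + cross (symtens X Y) g.
Proof.
rewrite /rho lam_xD lam_yD lam_xy lam_yx crossDl -!addrA; congr (_ + _).
by rewrite [RHS]addrCA; congr (_ + _); rewrite addrC.
Qed.

Lemma symtensC X Y : symtens X Y = symtens Y X.
Proof. exact: addrC. Qed.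

Lemma inx_wbr X Y i : inx (wbr X Y i) = lieD dx (inx \o X) (inx \o Y) i.
Proof.
rewrite ffunE raddf_sum; apply: eq_bigr => a _ /=.
by rewrite raddfB /= !rmorphM /= !dx_inx.
Qed.

Lemma iny_wbr X Y i : iny (wbr X Y i) = lieD dy (iny \o X) (iny \o Y) i.
Proof.
rewrite ffunE raddf_sum; apply: eq_bigr => a _ /=.
by rewrite raddfB /= !rmorphM /= !dy_iny.
Qed.

Lemma rho_wbr X Y g : rho (wbr X Y) g = rho X (rho Y g) - rho Y (rho X g).
Proof.
rewrite !rho_rho [symtens Y X]symtensC opprD addrACA subrr addr0 opprD addrACA.
have subE (u v : T) p : (u - v) p = u p - v p by rewrite !ffunE.
congr (_ + _); apply/ffunP => -[i j].
  rewrite subE !lam_x_lieD lieD_jacobi; last exact: dxC.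
    by rewrite ffunE; apply: eq_lieD => // a; rewrite /= inx_wbr.
  exact: dxM.
rewrite subE !lam_y_lieD lieD_jacobi; last exact: dyC.
  by rewrite ffunE; apply: eq_lieD => // a; rewrite /= iny_wbr.
exact: dyM.
Qed.

(* The one-point parts of X Y + Y X only involve derivatives of order at most two of the
   symbol on the diagonal: when it vanishes to order three only the mixed part is left. *)
Definition pure_op t g : T :=
  [ffun p => sec_op inx dx t (fun a => g (a, p.2)) p.1
           + sec_op iny dy t (fun b => g (p.1, b)) p.2].

Lemma rho_sym X Y g : rho X (rho Y g) + rho Y (rho X g) =
  pure_op (symtens X Y) g + cross (symtens X Y) g *+ 2.
Proof.
rewrite !rho_rho [symtens Y X]symtensC addrACA -mulr2n; congr (_ + _).
have addE (u v : T) p : (u + v) p = u p + v p by rewrite !ffunE.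
apply/ffunP => -[i j]; rewrite addrACA !addE !lam_x_lieD !lam_y_lieD [RHS]ffunE /=.
by rewrite -!lieD_sym_sec_op //; [exact: dyM | exact: dy_iny | exact: dxM | exact: dx_inx].
Qed.

Lemma pure_opD t u g : pure_op (t + u) g = pure_op t g + pure_op u g.
Proof. by apply/ffunP => p; rewrite !ffunE !sec_opD addrACA. Qed.

Lemma pure_op0 t g : (forall p, vanish 3 (t p)) -> pure_op t g = 0.
Proof. by move=> vt; apply/ffunP => p; rewrite !ffunE !sec_op0 // addr0. Qed.

End Tensors.

Section Filtration.
Variables (k : fieldType) (n : nat) (D : two_point k n).
Local Notation A := (tpA D).
Local Notation P := (tpP D).
Local Notation W := {ffun 'I_n -> A}.
Local Notation T := {ffun 'I_n * 'I_n -> P}.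
Implicit Types (X Y : W) (t u g h : T).

Definition vanT r (t : T) := forall p, vanish r (t p).

Lemma vanT0 r : vanT r 0.
Proof. by move=> p; rewrite ffunE; apply: vanish0. Qed.

Lemma vanTD r t u : vanT r t -> vanT r u -> vanT r (t + u).
Proof. by move=> vt vu p; rewrite ffunE; apply: vanishD. Qed.

Lemma vanTZ r (a : k) t : vanT r t -> vanT r (a *: t).
Proof. by move=> vt p; rewrite ffunE; apply: vanishZ. Qed.

Lemma vanTB r t u : vanT r t -> vanT r u -> vanT r (t - u).
Proof. by move=> vt vu; rewrite -scaleN1r; apply: vanTD => //; apply: vanTZ. Qed.

Lemma vanT_sum r I (s : seq I) (Q : pred I) (F : I -> T) :
  (forall i, Q i -> vanT r (F i)) -> vanT r (\sum_(i <- s | Q i) F i).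
Proof. by move=> vF; apply: big_ind => //; [apply: vanT0 | apply: vanTD]. Qed.

Lemma rho_vanT r X g : vanT r g -> vanT r (rho X g).
Proof.
case: r => [//|r] vg p; rewrite !ffunE -big_split; apply: vanish_sum => a _ /=.
rewrite addrACA -opprD; apply: vanishB; last first.
  by apply: vanishD; rewrite mulrC; apply: vanish_mull; apply: vg.
rewrite -!surjective_pairing.
have -> : inx (X a) * dx a (g p) + iny (X a) * dy a (g p) =
    inx (X a) * (dx a (g p) + dy a (g p)) + (iny (X a) - inx (X a)) * dy a (g p) by ring.
apply: vanishD; first by apply: vanish_mull; apply: vanish_dxdy; apply: vg.
by rewrite -add1n; apply: vanishM (vanish_iny_inx _) (vanish_dy _ (vg _)).
Qed.

Definition vinv : T := [ffun p => zvar D p.1 * zvar D p.2].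

Lemma vinvE p : vinv p = zvar D p.1 * zvar D p.2.
Proof. exact: ffunE. Qed.

Lemma rho_vinv X : vanT 3 (rho X vinv).
Proof.
have vx i : vanish 2 (iny (X i) - inx (X i) - \sum_a zvar D a * inx (pd a (X i))).
  split=> [|b].
    rewrite !raddfB /= raddf_sum /= diag_inx diag_iny subrr big1 ?subr0 // => a _.
    by rewrite rmorphM /= (vanish_diag (vanish_zvar _ _)) mul0r.
  rewrite !raddfB /= raddf_sum /= dy_inx dy_iny subr0.
  under eq_bigr do rewrite dyM dy_zvar dy_inx mulr0 addr0 eq_sym.
  by rewrite sum_delta; apply: vanish_iny_inx.
have vy i : vanish 2 (iny (X i) - inx (X i) - \sum_a zvar D a * iny (pd a (X i))).
  split=> [|b].
    rewrite !raddfB /= raddf_sum /= diag_inx diag_iny subrr big1 ?subr0 // => a _.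
    by rewrite rmorphM /= (vanish_diag (vanish_zvar _ _)) mul0r.
  rewrite !raddfB /= raddf_sum /= dy_inx dy_iny subr0.
  under eq_bigr do rewrite dyM dy_zvar dy_iny eq_sym.
  rewrite big_split /= sum_delta opprD addNKr; apply: vanishN.
  by apply: vanish_sum => a _; rewrite mulrC; apply: vanish_mull; apply: vanish_zvar.
move=> [i j]; have -> : rho X vinv (i, j) =
    zvar D j * (iny (X i) - inx (X i) - \sum_a zvar D a * inx (pd a (X i)))
  + zvar D i * (iny (X j) - inx (X j) - \sum_a zvar D a * iny (pd a (X j))).
  have Ex : lam_x X vinv (i, j) = - (inx (X i) * zvar D j) - inx (X j) * zvar D i
      - zvar D j * \sum_a zvar D a * inx (pd a (X i)).
    rewrite ffunE mulr_sumr -(sum_delta (fun a => inx (X a) * zvar D j) i).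
    rewrite -(sum_delta (fun a => inx (X a) * zvar D i) j) -sumrN -!sumrB.
    by apply: eq_bigr => a _; rewrite !vinvE /= dxM !dx_zvar dx_inx; ring.
  have Ey : lam_y X vinv (i, j) = iny (X i) * zvar D j + iny (X j) * zvar D i
      - zvar D i * \sum_a zvar D a * iny (pd a (X j)).
    rewrite ffunE mulr_sumr -(sum_delta (fun a => iny (X a) * zvar D j) i).
    rewrite -(sum_delta (fun a => iny (X a) * zvar D i) j) -big_split -sumrB.
    by apply: eq_bigr => a _; rewrite !vinvE /= dyM !dy_zvar dy_iny; ring.
  by rewrite ffunE Ex Ey; ring.
by apply: vanishD; apply: (@vanishM _ _ _ 1 2) => //; apply: vanish_zvar.
Qed.

Lemma cross_vanT r t g : (2 <= r)%N -> vanT r t -> vanT 3 g -> vanT r.+1 (cross t g).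
Proof.
case: r => [//|[//|r]] _ vt vg p; rewrite ffunE.
apply: vanish_sum => a _; apply: vanish_sum => b _.
apply: vanishD; [apply: vanishB; [apply: vanishB|]|].
- rewrite -addn1; apply: vanishM (vt _) _.
  by apply: vanish_dx; apply: vanish_dy; apply: vg.
- rewrite -addn2; apply: vanishM (vanish_dy _ (vt _)) _.
  by apply: vanish_dx; apply: vg.
- rewrite -addn2; apply: vanishM; first by apply: vanish_dx; apply: vt.
  by apply: vanish_dy; apply: vg.
rewrite -addn3; apply: vanishM (vg _).
by apply: vanish_dx; apply: vanish_dy; apply: vt.
Qed.

Definition div1 t j : P := \sum_a dy a (t (a, j)).
Definition div2 t i : P := \sum_a dy a (t (i, a)).

Lemma dx_nat (i : 'I_n) e : dx i (e%:R : P) = 0.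
Proof. by rewrite -(rmorph_nat iny) dx_iny. Qed.

Lemma cross_vinv t i j : cross t vinv (i, j) =
  - t (j, i) - t (i, j) + \sum_b zvar D b * dy b (t (i, j)) + zvar D i * div1 t j
  - zvar D j * \sum_a dx a (t (i, a)) - \sum_a zvar D a * dx a (t (i, j))
  + \sum_a \sum_b zvar D a * zvar D b * dx a (dy b (t (i, j))).
Proof.
have E1 : \sum_a \sum_b ((b == i)%:R * ((a == j)%:R * t (a, b))) = t (j, i).
  rewrite exchange_big /=; under eq_bigr do rewrite -mulr_sumr.
  by rewrite sum_delta sum_delta.
have E2 : \sum_a \sum_b ((a == i)%:R * ((b == j)%:R * t (a, b))) = t (i, j).
  by under eq_bigr do rewrite -mulr_sumr; rewrite sum_delta sum_delta.
have E3 : \sum_a \sum_b ((a == i)%:R * (zvar D b * dy b (t (a, j)))) =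
   \sum_b zvar D b * dy b (t (i, j)).
  by under eq_bigr do rewrite -mulr_sumr; rewrite sum_delta.
have E4 : \sum_a \sum_b ((b == a)%:R * (zvar D i * dy b (t (a, j)))) = zvar D i * div1 t j.
  by under eq_bigr do rewrite sum_delta; rewrite -mulr_sumr.
have E5 : \sum_a \sum_b ((b == a)%:R * (zvar D j * dx a (t (i, b)))) =
    zvar D j * \sum_a dx a (t (i, a)).
  by under eq_bigr do rewrite sum_delta; rewrite -mulr_sumr.
have E6 : \sum_a \sum_b ((b == j)%:R * (zvar D a * dx a (t (i, b)))) =
    \sum_a zvar D a * dx a (t (i, j)).
  by under eq_bigr do rewrite sum_delta.
rewrite -E1 -{1}E2 -E3 -E4 -E5 -E6 ffunE -!sumrN -!big_split; apply: eq_bigr => a _ /=.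
rewrite -!sumrN -!big_split; apply: eq_bigr => b _ /=.
rewrite !ffunE /= !dyM !dxM raddfD /= !dxM !dy_zvar !dx_zvar.
rewrite !dx_nat (eq_sym a b); ring.
Qed.

End Filtration.

Section Injectivity.
Variables (k : fieldType) (n : nat) (D : two_point k n).
Hypothesis char0 : [pchar k] =i pred0.
Local Notation P := (tpP D).
Local Notation T := {ffun 'I_n * 'I_n -> P}.
Implicit Type t : T.

Lemma vanish_mulrn_cancel r e (g : P) : (0 < e)%N -> vanish r (g *+ e) -> vanish r g.
Proof. by move=> e0; apply: vanish_natr_cancel; rewrite (pcharf0P k).1 // -lt0n. Qed.

Lemma vanish_mulrn r e (g : P) : vanish r g -> vanish r (g *+ e).
Proof. by move=> vg; rewrite -scaler_nat; apply: vanishZ. Qed.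

Lemma vanish_congr r (g h : P) : vanish r (h - g) -> vanish r h -> vanish r g.
Proof. by move=> hg vh; rewrite -[g](subKr h); apply: vanishB. Qed.

Lemma vanish_div1 r t j : vanT r.+1 t -> vanish r (div1 t j).
Proof. by move=> vt; apply: vanish_sum => a _; apply: vanish_dy; apply: vt. Qed.

Lemma vanish_div2 r t i : vanT r.+1 t -> vanish r (div2 t i).
Proof. by move=> vt; apply: vanish_sum => a _; apply: vanish_dy; apply: vt. Qed.

(* [q ^ 2 + 3 q + 1] is [r ^ 2 - 3 r + 1] for [r = q + 3]. *)
Lemma cross_vinv_congr q t i j : vanT q.+3 t -> vanish q.+4 (cross t (vinv D) (i, j)) ->
  vanish q.+4 (t (i, j) *+ (q * q + 3 * q + 1) + t (j, i)
               - zvar D i * div1 t j - zvar D j * div2 t i).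
Proof.
move=> vt; set r := q.+3; set f := t (i, j).
have vf : vanish r f by apply: vt.
have H1 : vanish r.+1 (\sum_a zvar D a * dy a f - f *+ r) by apply: vanish_euler.
have H2 : vanish r.+1 (\sum_a zvar D a * (dx a f + dy a f)).
  by apply: vanish_sum => a _; apply: vanish_zvarM; apply: vanish_dxdy.
have H3 : vanish r.+1 (zvar D j * \sum_a (dx a (t (i, a)) + dy a (t (i, a)))).
  by apply: vanish_zvarM; apply: vanish_sum => a _; apply: vanish_dxdy; apply: vt.
have H4 : vanish r.+1 (\sum_b zvar D b *
    (\sum_a zvar D a * (dx a (dy b f) + dy a (dy b f)))).
  apply: vanish_sum => b _; apply: vanish_zvarM; apply: vanish_sum => a _.
  by apply: vanish_zvarM; apply: vanish_dxdy; apply: vanish_dy.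
have H5 : vanish r.+1 (\sum_b zvar D b * (\sum_a zvar D a * dy a (dy b f) - dy b f *+ q.+2)).
  apply: vanish_sum => b _; apply: vanish_zvarM; apply: vanish_euler.
  exact: vanish_dy.
move=> Hc; apply: (@vanish_congr _ _ 0); last exact: vanish0.
have := vanishD (vanishB (vanishD (vanishD (vanishD Hc H2) H3) H5) H4) (vanish_mulrn q H1).
congr vanish; rewrite cross_vinv -/f /div2.
have -> : \sum_a zvar D a * (dx a f + dy a f) =
    \sum_a zvar D a * dx a f + \sum_a zvar D a * dy a f.
  by rewrite -big_split; apply: eq_bigr => a _; rewrite mulrDr.
rewrite (big_split _ _ _ (fun a => dx a (t (i, a)))) /=.
have -> : \sum_b zvar D b * (\sum_a zvar D a * dy a (dy b f) - dy b f *+ q.+2) =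
    \sum_b zvar D b * (\sum_a zvar D a * dy a (dy b f)) - (\sum_b zvar D b * dy b f) *+ q.+2.
  by rewrite -sumrMnl -sumrB; apply: eq_bigr => b _; rewrite mulrBr mulrnAr.
have -> : \sum_b zvar D b * (\sum_a zvar D a * (dx a (dy b f) + dy a (dy b f))) =
    \sum_a \sum_b zvar D a * zvar D b * dx a (dy b f)
    + \sum_b zvar D b * (\sum_a zvar D a * dy a (dy b f)).
  rewrite exchange_big -big_split; apply: eq_bigr => b _ /=.
  rewrite !mulr_sumr -big_split /=.
  by apply: eq_bigr => a _; ring.
rewrite /r /div1; ring.
Qed.

Lemma cross_vinv_inj q t : (2 * n + 2 <= q)%N -> vanT q.+3 t ->
  vanT q.+4 (cross t (vinv D)) -> vanT q.+4 t.
Proof.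
move=> le_q vt vc; pose c := (q * q + 3 * q + 1)%N.
pose e1 := (c - (n + q + 2))%N; pose e2 := (e1 - (n + q + 1))%N.
pose al := div1 t; pose be := div2 t; pose ga := \sum_i dy i (be i).
have ga_al : ga = \sum_j dy j (al j).
  rewrite /ga /al /be /div1 /div2; under eq_bigr do rewrite raddf_sum /=.
  rewrite exchange_big /=; apply: eq_bigr => b _; rewrite raddf_sum /=.
  by apply: eq_bigr => a _; rewrite dyC.
have Val j : vanish q.+2 (al j) by apply: vanish_div1.
have Vbe i : vanish q.+2 (be i) by apply: vanish_div2.
have Vga : vanish q.+1 ga by apply: vanish_sum => i _; apply: vanish_dy.
have E i j : vanish q.+4 (t (i, j) *+ c + t (j, i) - zvar D i * al j - zvar D j * be i).
  by apply: cross_vinv_congr.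
have dsum (f : P) : \sum_i dy i (zvar D i * f) = f *+ n + \sum_i zvar D i * dy i f.
  under eq_bigr do rewrite dyM dy_zvar eqxx mul1r.
  by rewrite big_split /= sumr_const card_ord.
have dsum2 (f : 'I_n -> P) j : \sum_i dy i (zvar D j * f i) = f j + zvar D j * \sum_i dy i (f i).
  under eq_bigr do rewrite dyM dy_zvar.
  by rewrite big_split /= sum_delta -mulr_sumr.
have Fal j : vanish q.+3 (al j *+ e1 - zvar D j * ga).
  have E1 : vanish q.+3
      (\sum_i dy i (t (i, j) *+ c + t (j, i) - zvar D i * al j - zvar D j * be i)).
    by apply: vanish_sum => i _; apply: vanish_dy.
  have E2 := vanish_euler (Val j).
  apply: vanish_congr (vanishD E1 E2).
  under eq_bigr do rewrite !raddfB raddfD raddfMn /=.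
  rewrite !sumrB big_split sumrMnl /= dsum dsum2 -/(div1 t j) -/(div2 t j) -/(al j) -/(be j) -/ga.
  have -> : al j *+ c = al j *+ e1 + al j *+ n + al j *+ q.+2.
    by rewrite -!mulrnDr; congr (_ *+ _); rewrite /e1 /c; nia.
  rewrite (_ : _ - _ = 0); first exact: vanish0.
  by ring.
have Fbe i : vanish q.+3 (be i *+ e1 - zvar D i * ga).
  have E1 : vanish q.+3
      (\sum_j dy j (t (i, j) *+ c + t (j, i) - zvar D i * al j - zvar D j * be i)).
    by apply: vanish_sum => j _; apply: vanish_dy.
  have E2 := vanish_euler (Vbe i).
  apply: vanish_congr (vanishD E1 E2).
  under eq_bigr do rewrite !raddfB raddfD raddfMn /=.
  rewrite !sumrB big_split sumrMnl /= dsum dsum2 -/(div1 t i) -/(div2 t i) -/(al i) -/(be i) -ga_al.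
  have -> : be i *+ c = be i *+ e1 + be i *+ n + be i *+ q.+2.
    by rewrite -!mulrnDr; congr (_ *+ _); rewrite /e1 /c; nia.
  rewrite (_ : _ - _ = 0); first exact: vanish0.
  by ring.
have Fga : vanish q.+2 (ga *+ e2).
  have E1 : vanish q.+2 (\sum_j dy j (al j *+ e1 - zvar D j * ga)).
    by apply: vanish_sum => j _; apply: vanish_dy.
  have E2 := vanish_euler Vga.
  apply: vanish_congr (vanishD E1 E2).
  under eq_bigr do rewrite raddfB raddfMn /=.
  rewrite sumrB sumrMnl -ga_al.
  rewrite dsum.
  have -> : ga *+ e1 = ga *+ e2 + ga *+ n + ga *+ q.+1.
    by rewrite -!mulrnDr; congr (_ *+ _); rewrite /e2 /e1 /c; nia.
  rewrite (_ : _ - _ = 0); first exact: vanish0.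
  by ring.
have {}Vga : vanish q.+2 ga by apply: vanish_mulrn_cancel Fga; rewrite /e2 /e1 /c; nia.
have {}Val j : vanish q.+3 (al j).
  apply: (@vanish_mulrn_cancel _ e1); first by rewrite /e1 /c; nia.
  by rewrite -[_ *+ _](subrK (zvar D j * ga)); apply: vanishD => //; apply: vanish_zvarM.
have {}Vbe i : vanish q.+3 (be i).
  apply: (@vanish_mulrn_cancel _ e1); first by rewrite /e1 /c; nia.
  by rewrite -[_ *+ _](subrK (zvar D i * ga)); apply: vanishD => //; apply: vanish_zvarM.
have {}E i j : vanish q.+4 (t (i, j) *+ c + t (j, i)).
  rewrite -[_ + _](subrK (zvar D i * al j)); apply: vanishD; last exact: vanish_zvarM.
  by rewrite -[_ - _](subrK (zvar D j * be i)); apply: vanishD; last exact: vanish_zvarM.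
move=> [i j]; apply: (@vanish_mulrn_cancel _ (c * c - 1)); first by rewrite /c; nia.
have := vanishB (vanish_mulrn c (E i j)) (E j i).
congr vanish; rewrite -[in RHS](addrK (t (i, j)) (_ *+ _)) -mulrSr.
have -> : (c * c - 1).+1 = (c * c)%N by rewrite /c; nia.
by rewrite mulrnA; ring.
Qed.

End Injectivity.

(** * The descent argument *)

Section Descent.
Variables (k : fieldType) (n : nat) (D : two_point k n).
Hypothesis char0 : [pchar k] =i pred0.
Local Notation A := (tpA D).
Local Notation P := (tpP D).
Local Notation W := {ffun 'I_n -> A}.
Local Notation T := {ffun 'I_n * 'I_n -> P}.
Implicit Types (X Y Z : W) (t u g h : T) (f p : A).

Lemma rho_tens Z X Y : rho Z (tens X Y) = tens (wbr Z X) Y + tens X (wbr Z Y).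
Proof.
apply/ffunP => -[i j]; rewrite !ffunE /=; congr (_ + _).
  rewrite -[\sum_(_ < _) _](ffunE (fun j => \sum_i (Z i * pd i (X j) - X i * pd i (Z j)))).
  rewrite -[finfun _]/(wbr Z X) inx_wbr mulr_suml.
  by apply: eq_bigr => a _; rewrite !ffunE /= dxM dx_iny; ring.
rewrite -[\sum_(_ < _) _](ffunE (fun j => \sum_i (Z i * pd i (Y j) - Y i * pd i (Z j)))).
rewrite -[finfun _]/(wbr Z Y) iny_wbr mulr_sumr.
by apply: eq_bigr => a _; rewrite !ffunE /= dyM dy_inx; ring.
Qed.

Lemma rho_symtens Z X Y :
  rho Z (symtens X Y) = symtens (wbr Z X) Y + symtens X (wbr Z Y).
Proof. by rewrite rhoD !rho_tens [X in _ + X = _]addrC addrACA. Qed.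

Lemma symtensZ (a : k) X Y : symtens (a *: X) Y = a *: symtens X Y.
Proof.
by apply/ffunP => p; rewrite !ffunE !linearZ /= scalerDr -scalerAl -scalerAr.
Qed.

Definition symL (L : W -> Prop) t := exists2 s : seq (W * W),
  (forall q, q \in s -> L q.1 /\ L q.2) & t = \sum_(q <- s) symtens q.1 q.2.

Section SymL.
Variable L : W -> Prop.
Hypothesis LZ : forall (a : k) X, L X -> L (a *: X).
Hypothesis Lbr : forall X Y, L X -> L Y -> L (wbr X Y).

Lemma symL_tens X Y : L X -> L Y -> symL L (symtens X Y).
Proof.
move=> LX LY; exists [:: (X, Y)]; last by rewrite big_seq1.
by move=> q; rewrite inE => /eqP ->.
Qed.

Lemma symL0 : symL L 0.
Proof. by exists [::]; rewrite ?big_nil. Qed.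

Lemma symLD t u : symL L t -> symL L u -> symL L (t + u).
Proof.
move=> [s Ls ->] [s' Ls' ->]; exists (s ++ s'); last by rewrite big_cat.
by move=> q; rewrite mem_cat => /orP[/Ls|/Ls'].
Qed.

Lemma symLZ (a : k) t : symL L t -> symL L (a *: t).
Proof.
move=> [s Ls ->]; elim: s Ls => [|q s IH] Ls; first by rewrite big_nil scaler0; apply: symL0.
rewrite big_cons scalerDr; apply: symLD.
  rewrite -symtensZ; case: (Ls q); rewrite ?inE ?eqxx // => L1 L2.
  by apply: symL_tens => //; apply: LZ.
by apply: IH => q' s_q'; apply: Ls; rewrite inE s_q' orbT.
Qed.

Lemma symL_sum I (s : seq I) (Q : pred I) (F : I -> T) :
  (forall i, Q i -> symL L (F i)) -> symL L (\sum_(i <- s | Q i) F i).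
Proof. by move=> h; apply: big_ind => //; [apply: symL0 | apply: symLD]. Qed.

Lemma symL_rho Z t : L Z -> symL L t -> symL L (rho Z t).
Proof.
move=> LZ' [s Ls ->]; elim: s Ls => [|q s IH] Ls.
  by rewrite big_nil raddf0; apply: symL0.
rewrite big_cons rhoD; apply: symLD.
  rewrite rho_symtens; case: (Ls q); rewrite ?inE ?eqxx // => L1 L2.
  by apply: symLD; apply: symL_tens => //; apply: Lbr.
by apply: IH => q' s_q'; apply: Ls; rewrite inE s_q' orbT.
Qed.

End SymL.

Definition app Z f : A := \sum_a Z a * pd a f.

Lemma appM Z f p : app Z (f * p) = app Z f * p + f * app Z p.
Proof.
rewrite mulr_suml mulr_sumr -big_split; apply: eq_bigr => a _ /=.
by rewrite pdM; ring.
Qed.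

Lemma appX Z p e : app Z (p ^+ e.+1) = (p ^+ e * app Z p) *+ e.+1.
Proof.
elim: e => [|e IH]; first by rewrite expr1 expr0 mul1r.
by rewrite exprS appM IH [p ^+ e.+1]exprS; ring.
Qed.

Lemma app1 Z : app Z 1 = 0.
Proof.
have /eqP := appM Z 1 1.
by rewrite !mulr1 mul1r -subr_eq0 opprD addNKr oppr_eq0 => /eqP.
Qed.

Definition scal f t : T := [ffun q => inx f * t q].

Lemma rho_scal Z f t : rho Z (scal f t) = scal (app Z f) t + scal f (rho Z t).
Proof.
apply/ffunP => -[i j]; rewrite !ffunE /= mulrDr addrA; congr (_ + _); last first.
  rewrite mulr_sumr; apply: eq_bigr => a _.
  by rewrite !ffunE /= dyM dy_inx; ring.
rewrite /app raddf_sum mulr_suml mulr_sumr -big_split; apply: eq_bigr => a _ /=.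
by rewrite !ffunE /= dxM dx_inx rmorphM /=; ring.
Qed.

Lemma vanT_scal r f t : vanT r t -> vanT r (scal f t).
Proof. by move=> vt q; rewrite ffunE; apply: vanish_mull. Qed.

Lemma vanT_scal_cancel r f t : f != 0 -> vanT r (scal f t) -> vanT r t.
Proof. by move=> f0 vt q; have := vt q; rewrite ffunE; apply: vanish_inx_cancel. Qed.

Lemma scal_sum f I (s : seq I) (F : I -> T) :
  scal f (\sum_(i <- s) F i) = \sum_(i <- s) scal f (F i).
Proof.
apply/ffunP => q; rewrite ffunE !sum_ffunE mulr_sumr.
by apply: eq_bigr => i _; rewrite ffunE.
Qed.

(* Applying [Z] lowers the exponents, since [Z] kills the [u i] to the next order. *)
Lemma vanT_powers r Z p d (u : nat -> T) : app Z p != 0 ->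
  (forall i, vanT r (rho Z (u i))) ->
  vanT r (\sum_(i < d) scal (p ^+ i) (u i)) -> forall i, (i < d)%N -> vanT r (u i).
Proof.
move=> Zp; elim: d u => [//|d IH] u Zu vS.
have tail i : (i < d)%N -> vanT r (u i.+1).
  have : vanT r (\sum_(i < d) scal (p ^+ i) (u i.+1 *+ i.+1)).
    apply: (vanT_scal_cancel Zp); rewrite scal_sum.
    have := rho_vanT Z vS; rewrite raddf_sum /=.
    under eq_bigr do rewrite rho_scal.
    rewrite big_split /= => vS'.
    have := vanTB vS' (vanT_sum (index_enum _) (Q := xpredT)
      (F := fun i : 'I_d.+1 => scal (p ^+ i) (rho Z (u i))) (fun i _ => vanT_scal _ (Zu i))).
    rewrite addrK big_ord_recl expr0 app1.
    congr vanT; rewrite [scal 0 _](_ : _ = 0) ?add0r; last first.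
      by apply/ffunP => q; rewrite !ffunE rmorph0 mul0r.
    apply: eq_bigr => j _; apply/ffunP => q.
    rewrite lift0 !ffunE appX raddfMn /= rmorphM /=.
    have mulrnE (v : T) e : (v *+ e) q = v q *+ e by rewrite -!scaler_nat ffunE.
    by rewrite mulrnE; ring.
  move=> vS' i_d q; have Zu' j : vanT r (rho Z (u j.+1 *+ j.+1)).
    by rewrite -scaler_nat rhoZ; apply: vanTZ.
  have := IH (fun j => u j.+1 *+ j.+1) Zu' vS' i i_d q.
  have -> : (u i.+1 *+ i.+1) q = u i.+1 q *+ i.+1 by rewrite -!scaler_nat ffunE.
  exact: vanish_mulrn_cancel.
move=> [|i] //; last exact: tail.
have := vS; rewrite big_ord_recl expr0 => v0 _.
have -> : u 0%N = scal 1 (u 0%N) by apply/ffunP => q; rewrite ffunE rmorph1 mul1r.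
rewrite -[scal 1 _](addrK (\sum_(i < d) scal (p ^+ i.+1) (u i.+1))); apply: vanTB => //.
by apply: vanT_sum => i _; apply: vanT_scal; apply: tail.
Qed.

Lemma vanT_descent (F : T -> Prop) Z p d (u : nat -> T) r e : app Z p != 0 ->
  (forall s t, (r <= s < r + e)%N -> F t -> vanT s t -> vanT s.+1 (rho Z t)) ->
  (forall i, F (u i)) -> (forall i, vanT r (u i)) ->
  \sum_(i < d) scal (p ^+ i) (u i) = 0 -> forall i, (i < d)%N -> vanT (r + e) (u i).
Proof.
move=> Zp ZF Fu vu u0.
suff: forall s, (s <= e)%N -> forall i, (i < d)%N -> vanT (r + s) (u i) by apply.
pose u' i := if (i < d)%N then u i else 0.
have u'0 : \sum_(i < d) scal (p ^+ i) (u' i) = 0.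
  by rewrite -[RHS]u0; apply: eq_bigr => i _; rewrite /u' ltn_ord.
elim=> [|s IH] le_s i i_d; first by rewrite addn0.
suff : vanT (r + s.+1) (u' i) by rewrite /u' i_d.
apply: (vanT_powers Zp _ _ i_d) => [j|]; last by rewrite u'0; apply: vanT0.
rewrite /u'; case: ifP => j_d; last first.
  by rewrite raddf0; apply: vanT0.
rewrite addnS; apply: ZF => //; first by rewrite leq_addr ltn_add2l.
by apply: IH => //; apply: ltnW.
Qed.

End Descent.

(** * Consequences of the noetherian property *)

Section WordAction.
Variables (k : fieldType) (K : choiceType) (M : lmodType k) (op : K -> {linear M -> M}).
Local Notation FA := (malg (fmonom K) k).

Definition word_act (m : fmonom K) (g : M) : M := foldr (fun x => op x) g (fmonom_val m).

Definition act (w : FA) (g : M) : M :=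
  \sum_(m <- msupp w) mcoeff m w *: word_act m g.

Lemma word_act_lin m : linear (word_act m).
Proof.
rewrite /word_act => c g h.
by elim: (fmonom_val m) => //= x s ->; rewrite linearP.
Qed.

HB.instance Definition _ m := GRing.isLinear.Build k M M *:%R (word_act m) (word_act_lin m).

Lemma act_lin w : linear (act w).
Proof.
move=> c g h; rewrite /act scaler_sumr -big_split; apply: eq_bigr => m _ /=.
by rewrite linearP scalerDr !scalerA mulrC.
Qed.

HB.instance Definition _ w := GRing.isLinear.Build k M M *:%R (act w) (act_lin w).

Lemma actEw (d : {fset fmonom K}) w g : (msupp w `<=` d)%fset ->
  act w g = \sum_(m <- d) mcoeff m w *: word_act m g.
Proof.
move=> le; rewrite /act (big_fset_incl _ le) // => m _ /mcoeff_outdom ->.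
by rewrite scale0r.
Qed.

Lemma actD u w g : act (u + w) g = act u g + act w g.
Proof.
pose d := (msupp u `|` msupp w)%fset.
rewrite (@actEw d _ _ (msuppD_le _ _)) (@actEw d u) ?fsubsetUl // (@actEw d w) ?fsubsetUr //.
by rewrite -big_split; apply: eq_bigr => m _; rewrite mcoeffD scalerDl.
Qed.

Lemma act0 g : act 0 g = 0.
Proof. by rewrite /act msupp0 big_nil. Qed.

Lemma actZ (c : k) w g : act (c *: w) g = c *: act w g.
Proof.
rewrite (actEw _ (msuppZ_le c w)) scaler_sumr.
by apply: eq_bigr => m _; rewrite mcoeffZ scalerA.
Qed.

Lemma actN w g : act (- w) g = - act w g.
Proof. by have := actZ (-1) w g; rewrite !scaleN1r. Qed.

Lemma act_sum I (s : seq I) (F : I -> FA) g :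
  act (\sum_(i <- s) F i) g = \sum_(i <- s) act (F i) g.
Proof.
elim: s => [|i s IH]; first by rewrite !big_nil act0.
by rewrite !big_cons actD IH.
Qed.

Lemma actU c m g : act (mkmalgU m c) g = c *: word_act m g.
Proof. by rewrite (actEw _ msuppU_le) big_seq_fset1 mcoeffUU. Qed.

Lemma act_letter x g : act (mkmalgU (fmu x) 1) g = op x g.
Proof. by rewrite actU scale1r /word_act fmuE. Qed.

Lemma word_actM m1 m2 g : word_act (mmul m1 m2) g = word_act m1 (word_act m2 g).
Proof. by rewrite /word_act -foldr_cat -fmM. Qed.

Lemma actM u w g : act (u * w) g = act u (act w g).
Proof.
rewrite malgME act_sum [RHS]/act; apply: eq_bigr => m1 _.
rewrite act_sum [act w g]/act.
rewrite linear_sum scaler_sumr; apply: eq_bigr => m2 _.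
by rewrite actU word_actM linearZ scalerA.
Qed.

Lemma act_commutator u w z g :
  act (u * w - w * u - z) g = act u (act w g) - act w (act u g) - act z g.
Proof.
rewrite actD actN actD actN; congr (_ - _ - _); exact: actM.
Qed.

Lemma act_combination c u w z g :
  act (z - (c *: u + w)) g = act z g - (c *: act u g + act w g).
Proof. by rewrite actD actN actD actZ. Qed.

End WordAction.

Section Noetherian.
Variables (k : fieldType) (n : nat) (D : two_point k n) (K : choiceType).
Hypothesis char0 : [pchar k] =i pred0.
Local Notation W := {ffun 'I_n -> tpA D}.
Local Notation T := {ffun 'I_n * 'I_n -> tpP D}.
Local Notation FA := (malg (fmonom K) k).
Variable (ev : K -> W).
Local Notation v := (vinv D).

Definition rhoK (x : K) : {linear T -> T} := rho (ev x).
Lemma rhoKE x g : rhoK x g = rho (ev x) g. Proof. by []. Qed.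

Definition Limg (X : W) := exists x, ev x = X.

Lemma word_sym t : symL Limg t ->
  exists w : FA, forall g, act rhoK w g = pure_op t g + cross t g *+ 2.
Proof.
move=> [s Ls ->]; elim: s Ls => [|q s IH] Ls.
  exists 0 => g; rewrite act0 big_nil.
  have -> : cross (0 : T) g = 0 by have := crossZl 0 (0 : T) g; rewrite !scale0r.
  by rewrite mul0rn addr0 pure_op0 // => p; rewrite ffunE; apply: vanish0.
have [w wE] : exists w : FA, forall g, act rhoK w g =
    pure_op (\sum_(q <- s) symtens q.1 q.2) g + cross (\sum_(q <- s) symtens q.1 q.2) g *+ 2.
  by apply: IH => q' s_q'; apply: Ls; rewrite inE s_q' orbT.
have [[x xE] [y yE]] : Limg q.1 /\ Limg q.2 by apply: Ls; rewrite inE eqxx.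
have [lx ax] : exists lx : FA, forall h, act rhoK lx h = rho q.1 h.
  by exists (mkmalgU (fmu x) 1) => h; rewrite act_letter rhoKE xE.
have [ly ay] : exists ly : FA, forall h, act rhoK ly h = rho q.2 h.
  by exists (mkmalgU (fmu y) 1) => h; rewrite act_letter rhoKE yE.
exists (lx * ly + ly * lx + w) => g.
have -> : act rhoK (lx * ly + ly * lx + w) g =
    rho q.1 (rho q.2 g) + rho q.2 (rho q.1 g) + act rhoK w g.
  by rewrite actD actD; congr (_ + _ + _); rewrite actM ?ax ?ay.
rewrite wE big_cons.
by rewrite pure_opD crossDl mulrnDl [RHS]addrACA rho_sym.
Qed.

Lemma word_act_vanT r m g : vanT r g -> vanT r (word_act rhoK m g).
Proof.
rewrite /word_act => vg; elim: (fmonom_val m) => //= x s IH.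
exact: rho_vanT.
Qed.

Lemma act_vanT r w g : vanT r g -> vanT r (act rhoK w g).
Proof. by move=> vg; apply: vanT_sum => m _; apply: vanTZ; apply: word_act_vanT. Qed.

Lemma word_act_vinv m : exists c : k, vanT 3 (word_act rhoK m v - c *: v).
Proof.
rewrite /word_act; elim: (fmonom_val m) => [|x s [c IH]] /=.
  by exists 1; rewrite scale1r subrr; apply: vanT0.
exists 0; rewrite scale0r subr0 -[foldr _ _ _](subrK (c *: v)) linearD /=.
apply: vanTD; first exact: rho_vanT.
by rewrite linearZ /=; apply: vanTZ; apply: rho_vinv.
Qed.

Lemma act_vinv w : exists c : k, vanT 3 (act rhoK w v - c *: v).
Proof.
rewrite /act; elim: (enum_fset (msupp w)) => [|m s [c IH]].
  by exists 0; rewrite big_nil scale0r subrr; apply: vanT0.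
have [e He] := word_act_vinv m; exists (mcoeff m w * e + c).
rewrite big_cons scalerDl opprD addrACA -scalerA -scalerBr.
by apply: vanTD => //; apply: vanTZ.
Qed.

Lemma sym_quotient_finite (q : nat) (J : FA -> Prop) :
  (2 * n + 2 <= q)%N ->
  (forall w, J w -> forall g, act rhoK w g = 0) ->
  (forall I : nat -> FA -> Prop,
     (forall m, [/\ I m 0, forall w u, I m w -> I m u -> I m (w + u),
        forall a w, I m w -> I m (w * a), forall w, J w -> I m w &
        forall w, I m w -> I m.+1 w]) ->
     exists N, forall m, (N <= m)%N -> forall w, I m w -> I N w) ->
  exists s : seq T, (forall i, symL Limg s`_i /\ vanT q.+3 s`_i) /\
    forall t, symL Limg t -> vanT q.+3 t ->
      exists c : nat -> k, vanT q.+4 (t - \sum_(i < size s) c i *: s`_i).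
Proof.
move=> le_q J0 noeth; apply: contrapT => no_s.
have step (s : seq T) : exists t, (forall i, symL Limg s`_i /\ vanT q.+3 s`_i) ->
    [/\ symL Limg t, vanT q.+3 t &
      forall c : nat -> k, ~ vanT q.+4 (t - \sum_(i < size s) c i *: s`_i)].
  have [Hs|] := pselect (forall i, symL Limg s`_i /\ vanT q.+3 s`_i); last by exists 0.
  apply: contrapT => no_t; apply: no_s; exists s; split=> // t Lt vt.
  apply: contrapT => no_c; apply: no_t; exists t => _; split=> // c vc.
  by apply: no_c; exists c.
have [f fP] := choice step.
pose Ts m := iter m (fun s => rcons s (f s)) [::].
pose t_ m := f (Ts m).
have TsE m : Ts m = mkseq t_ m.
  by elim: m => //= m IH; rewrite mkseqS -IH.
have Ts_ok m : forall i, symL Limg (Ts m)`_i /\ vanT q.+3 (Ts m)`_i.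
  elim: m => [|m IH] i; first by rewrite nth_nil; split; [apply: symL0 | apply: vanT0].
  rewrite nth_rcons; case: ifP => _; first exact: IH.
  case: ifP => _; first by case: (fP _ IH).
  by split; [apply: symL0 | apply: vanT0].
have t_ok m : [/\ symL Limg (t_ m), vanT q.+3 (t_ m) &
    forall c : nat -> k, ~ vanT q.+4 (t_ m - \sum_(i < m) c i *: t_ i)].
  have [Lt vt ct] := fP _ (Ts_ok m); split=> // c vc; apply: (ct c).
  suff -> : \sum_(i < size (Ts m)) c i *: (Ts m)`_i = \sum_(i < m) c i *: t_ i by [].
  by rewrite TsE size_mkseq; apply: eq_bigr => i _; rewrite nth_mkseq.
pose th t : T := cross t v *+ 2.
pose I m (w : FA) := (forall g, vanT 3 g -> vanT q.+4 (act rhoK w g)) /\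
  exists c : nat -> k, vanT q.+4 (act rhoK w v - \sum_(i < m) c i *: th (t_ i)).
have Iact0 m w : (forall g, act rhoK w g = 0) -> I m w.
  move=> w0; split=> [g _|]; first by rewrite w0; apply: vanT0.
  exists (fun=> 0); rewrite w0 big1 ?subrr; first exact: vanT0.
  by move=> i _; rewrite scale0r.
have [m|N NP] := noeth I.
  split.
  - by apply: Iact0 => g; apply: act0.
  - move=> w u [w1 [c wc]] [u1 [e ue]]; split.
      by move=> g vg; rewrite actD; apply: vanTD; [apply: w1 | apply: u1].
    exists (fun i => c i + e i); rewrite actD.
    under eq_bigr do rewrite scalerDl.
    by rewrite big_split /= opprD addrACA; apply: vanTD.
  - move=> a w [w1 [c wc]]; split.
      by move=> g vg; rewrite actM; apply: w1; apply: act_vanT.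
    have [e ae] := act_vinv a; exists (fun i => e * c i).
    have -> : act rhoK (w * a) v = act rhoK w (act rhoK a v - e *: v) + e *: act rhoK w v.
      by rewrite actM -[LHS]/(act rhoK w (act rhoK a v)) -linearZ -linearD subrK.
    rewrite -addrA; apply: vanTD; first exact: (w1 _ ae).
    under eq_bigr do rewrite -scalerA.
    by rewrite -scaler_sumr -scalerBr; apply: vanTZ.
  - by move=> w /J0; apply: Iact0.
  - move=> w [w1 [c wc]]; split=> //; exists (fun i => if (i < m)%N then c i else 0).
    rewrite big_ord_recr /= ltnn scale0r addr0; congr (vanT _ (_ - _)): wc.
    by apply: eq_bigr => i _; rewrite ltn_ord.
have [Lt vt ct] := t_ok N.
have [w wE] := word_sym Lt.
have wE' g : act rhoK w g = cross (t_ N) g *+ 2.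
  by rewrite wE pure_op0 ?add0r // => p; apply: vanish_le (vt p).
have IN : I N.+1 w.
  split=> [g vg|].
    by rewrite wE' -scaler_nat; apply: vanTZ; apply: cross_vanT.
  exists (fun i => (i == N)%:R); rewrite big_ord_recr /= eqxx scale1r wE' big1 ?add0r.
    by rewrite subrr; apply: vanT0.
  by move=> i _; rewrite ltn_eqF ?scale0r.
have [_ [c]] := NP N.+1 (leqnSn N) w IN.
rewrite wE' => vc; apply: (ct c); apply: (cross_vinv_inj char0 le_q).
  by apply: vanTB => //; apply: vanT_sum => i _; apply: vanTZ; case: (t_ok i).
move=> p; apply: (vanish_mulrn_cancel char0 (isT : (0 < 2)%N)).
have := vc p; congr vanish.
have crossN u : cross (- u) v = - cross u v by rewrite -scaleN1r crossZl scaleN1r.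
have cross_sum m (F : 'I_m -> T) : cross (\sum_i F i) v = \sum_i cross (F i) v.
  apply: (big_morph (fun t => cross t v)) => [x y|]; first exact: crossDl.
  by have := crossZl 0 (0 : T) v; rewrite !scale0r.
have -> : \sum_(i < N) c i *: th (t_ i) = cross (\sum_(i < N) c i *: t_ i) v *+ 2.
  rewrite cross_sum -sumrMnl; apply: eq_bigr => i _.
  by rewrite crossZl scalerMnr.
by rewrite crossDl crossN -mulrnBl -!scaler_nat ffunE.
Qed.

End Noetherian.

(** * Polynomial functions of two points *)

From mathcomp Require Import mpoly.

Section MpolyExt.
Variables (k : fieldType) (n : nat) (B : comNzRingType).

Lemma rmorph_mpoly_ext (f g : {rmorphism mpoly n k -> B}) :
  (forall a : k, f a%:MP = g a%:MP) -> (forall i, f 'X_i = g 'X_i) -> f =1 g.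
Proof.
move=> fgC fgX p; rewrite [p]mpolyE !raddf_sum /=; apply: eq_bigr => m _.
rewrite -mul_mpolyC (rmorphM f) (rmorphM g) fgC mpolyXE_id !rmorph_prod /=.
by congr (_ * _); apply: eq_bigr => i _; rewrite !rmorphXn /= fgX.
Qed.

Lemma derivation_mpoly_ext (phi : {rmorphism mpoly n k -> B})
    (D E : {additive mpoly n k -> B}) :
  (forall p q, D (p * q) = D p * phi q + phi p * D q) ->
  (forall p q, E (p * q) = E p * phi q + phi p * E q) ->
  (forall a : k, D a%:MP = E a%:MP) -> (forall i, D 'X_i = E 'X_i) -> D =1 E.
Proof.
move=> hD hE hC hX p; rewrite [p]mpolyE !raddf_sum /=; apply: eq_bigr => m _.
rewrite -mul_mpolyC hD hE hC; congr (_ + _ * _).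
rewrite mpolyXE_id; elim/big_rec: _ => [|i q _ IH]; first by rewrite -mpolyC1 hC.
rewrite hD hE IH; congr (_ * _ + _); elim: (m i) => [|e IHe]; first by rewrite expr0 -mpolyC1 hC.
by rewrite exprS hD hE hX IHe.
Qed.

End MpolyExt.

Section Diagonal.
Variables (k : fieldType) (n : nat).
Local Notation A := (mpoly n k).
Local Notation P := (mpoly (n + n) k).

Definition xvars := [tuple 'X_(lshift n i) : P | i < n].
Definition yvars := [tuple 'X_(rshift n i) : P | i < n].
Definition mdiagvars : (n + n).-tuple A :=
  [tuple 'X_(match split i with inl j => j | inr j => j end) | i < n + n].
Definition minx : A -> P := comp_mpoly xvars.
Definition miny : A -> P := comp_mpoly yvars.
Definition mdiag : P -> A := comp_mpoly mdiagvars.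
Definition mdx (i : 'I_n) : P -> P := mderiv (lshift n i).
Definition mdy (i : 'I_n) : P -> P := mderiv (rshift n i).

Arguments minx : simpl never.
Arguments miny : simpl never.
Arguments mdiag : simpl never.
Arguments mdx : simpl never.
Arguments mdy : simpl never.

HB.instance Definition _ := GRing.RMorphism.copy minx (comp_mpoly xvars).
HB.instance Definition _ := GRing.Linear.copy minx (comp_mpoly xvars).
HB.instance Definition _ := GRing.RMorphism.copy miny (comp_mpoly yvars).
HB.instance Definition _ := GRing.Linear.copy miny (comp_mpoly yvars).
HB.instance Definition _ := GRing.RMorphism.copy mdiag (comp_mpoly mdiagvars).
HB.instance Definition _ := GRing.Linear.copy mdiag (comp_mpoly mdiagvars).
HB.instance Definition _ i := GRing.Linear.copy (mdx i) (mderiv (lshift n i)).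
HB.instance Definition _ i := GRing.Linear.copy (mdy i) (mderiv (rshift n i)).

Lemma minxX i : minx 'X_i = 'X_(lshift n i).
Proof. by rewrite /minx comp_mpolyXU -tnth_nth tnth_mktuple. Qed.
Lemma minyX i : miny 'X_i = 'X_(rshift n i).
Proof. by rewrite /miny comp_mpolyXU -tnth_nth tnth_mktuple. Qed.
Lemma mdiagX i : mdiag 'X_i = 'X_(match split i with inl j => j | inr j => j end).
Proof. by rewrite /mdiag comp_mpolyXU -tnth_nth tnth_mktuple. Qed.
Lemma minxC a : minx a%:MP = a%:MP. Proof. exact: comp_mpolyC. Qed.
Lemma minyC a : miny a%:MP = a%:MP. Proof. exact: comp_mpolyC. Qed.
Lemma mdiagC a : mdiag a%:MP = a%:MP. Proof. exact: comp_mpolyC. Qed.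

Lemma mdiag_inx : cancel minx mdiag.
Proof.
move=> p; apply: (rmorph_mpoly_ext (f := mdiag \o minx) (g := idfun)) => [a|i] /=.
  by rewrite minxC mdiagC.
by rewrite minxX mdiagX (unsplitK (inl i)).
Qed.

Lemma mdiag_iny : cancel miny mdiag.
Proof.
move=> p; apply: (rmorph_mpoly_ext (f := mdiag \o miny) (g := idfun)) => [a|i] /=.
  by rewrite minyC mdiagC.
by rewrite minyX mdiagX (unsplitK (inr i)).
Qed.

Lemma mderivXU (N : nat) (i j : 'I_N) : ('X_j)^`M(i) = (i == j)%:R :> mpoly N k.
Proof.
rewrite mderivX mnmE eq_sym; case: eqP => [->|_]; last by rewrite scale0r.
by rewrite scale1r -mpolyX0; congr 'X_[_]; apply/mnmP => l; rewrite !mnmE subnn.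
Qed.

Lemma mdxM i g h : mdx i (g * h) = mdx i g * h + g * mdx i h.
Proof. exact: mderivM. Qed.
Lemma mdyM i g h : mdy i (g * h) = mdy i g * h + g * mdy i h.
Proof. exact: mderivM. Qed.
Lemma mdxC i j g : mdx i (mdx j g) = mdx j (mdx i g).
Proof. exact: mderiv_comm. Qed.
Lemma mdyC i j g : mdy i (mdy j g) = mdy j (mdy i g).
Proof. exact: mderiv_comm. Qed.
Lemma mdxyC i j g : mdx i (mdy j g) = mdy j (mdx i g).
Proof. exact: mderiv_comm. Qed.

Lemma mdx_inx i p : mdx i (minx p) = minx (p^`M(i)).
Proof.
apply: (derivation_mpoly_ext (phi := minx) (D := mdx i \o minx) (E := minx \o mderiv i))
  => /= [f g|f g|a|j].
- by rewrite rmorphM mdxM.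
- by rewrite mderivM rmorphD !rmorphM.
- by rewrite minxC /mdx !mderivC raddf0.
by rewrite minxX /mdx !mderivXU rmorph_nat eq_lshift.
Qed.

Lemma mdy_iny i p : mdy i (miny p) = miny (p^`M(i)).
Proof.
apply: (derivation_mpoly_ext (phi := miny) (D := mdy i \o miny) (E := miny \o mderiv i))
  => /= [f g|f g|a|j].
- by rewrite rmorphM mdyM.
- by rewrite mderivM rmorphD !rmorphM.
- by rewrite minyC /mdy !mderivC raddf0.
by rewrite minyX /mdy !mderivXU rmorph_nat eq_rshift.
Qed.

Lemma mdx_iny i p : mdx i (miny p) = 0.
Proof.
apply: (derivation_mpoly_ext (phi := miny) (D := mdx i \o miny) (E := \0)) => /= [f g|f g|a|j].
- by rewrite rmorphM mdxM.
- by rewrite mul0r mulr0 addr0.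
- by rewrite minyC /mdx !mderivC.
by rewrite minyX /mdx !mderivXU eq_lrshift.
Qed.

Lemma mdy_inx i p : mdy i (minx p) = 0.
Proof.
apply: (derivation_mpoly_ext (phi := minx) (D := mdy i \o minx) (E := \0)) => /= [f g|f g|a|j].
- by rewrite rmorphM mdyM.
- by rewrite mul0r mulr0 addr0.
- by rewrite minxC /mdy !mderivC.
by rewrite minxX /mdy !mderivXU eq_rlshift.
Qed.

Lemma mdiag_dxdy i g : mdiag (mdx i g + mdy i g) = (mdiag g)^`M(i).
Proof.
apply: (derivation_mpoly_ext (phi := mdiag) (D := mdiag \o (mdx i \+ mdy i))
  (E := mderiv i \o mdiag)) => /= [f h|f h|a|j].
- by rewrite mdxM mdyM -!rmorphM -!rmorphD; congr (mdiag _); rewrite mulrDl mulrDr addrACA.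
- by rewrite rmorphM mderivM.
- by rewrite mdiagC /mdx /mdy !mderivC addr0 raddf0.
rewrite mdiagX mderivXU /mdx /mdy !mderivXU -natrD rmorph_nat; congr (_%:R).
case: (splitP j) => l /= jl.
  have -> : j = lshift n l by apply: val_inj.
  by rewrite eq_lshift eq_rlshift addn0.
have -> : j = rshift n l by apply: val_inj.
by rewrite eq_rshift eq_lrshift.
Qed.

End Diagonal.
Arguments minx {k n} _ : simpl never.
Arguments miny {k n} _ : simpl never.
Arguments mdiag {k n} _ : simpl never.
Arguments mdx {k n} i _ : simpl never.
Arguments mdy {k n} i _ : simpl never.

Section Degrees.
Variables (k : fieldType) (n : nat).
Implicit Type p : mpoly n k.

Lemma msize_leP p d :
  reflect (forall m, m \in msupp p -> (mdeg m < d)%N) (msize p <= d)%N.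
Proof.
rewrite msizeE; apply: (iffP idP) => [le_d m m_p|h].
  by apply: leq_trans le_d; rewrite (big_rem m) //= leq_maxl.
by rewrite big_seq; elim/big_ind: _ => // a b ha hb; rewrite geq_max ha.
Qed.

Lemma msize_mderiv p i d : (msize p <= d.+1)%N -> (msize p^`M(i) <= d)%N.
Proof.
move=> /msize_leP h; apply/msize_leP => m.
rewrite mcoeff_msupp mcoeff_mderiv => nz.
have /h : (m + U_(i))%MM \in msupp p.
  by rewrite mcoeff_msupp; apply: contra nz => /eqP ->; rewrite mul0rn.
by rewrite mdegD mdeg1 addn1 ltnS.
Qed.

Lemma msize_add p q d :
  (msize p <= d)%N -> (msize q <= d)%N -> (msize (p + q) <= d)%N.
Proof. by move=> hp hq; apply: leq_trans (msizeD_le p q) _; rewrite geq_max hp. Qed.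

Lemma msize_bigsum I (s : seq I) (Q : pred I) (F : I -> mpoly n k) d :
  (forall i, Q i -> (msize (F i) <= d)%N) -> (msize (\sum_(i <- s | Q i) F i) <= d)%N.
Proof.
by move=> h; elim/big_ind: _ => // [|p q hp hq]; [rewrite msize0 | apply: msize_add].
Qed.

Lemma msize_scale (a : k) p d : (msize p <= d)%N -> (msize (a *: p) <= d)%N.
Proof. by move=> h; apply: leq_trans h; apply: msizeZ_le. Qed.

Lemma msize_opp p d : (msize p <= d)%N -> (msize (- p) <= d)%N.
Proof. by rewrite -scaleN1r; apply: msize_scale. Qed.

Lemma msize_mul p q d e :
  (msize p <= d.+1)%N -> (msize q <= e.+1)%N -> (msize (p * q) <= (d + e).+1)%N.
Proof.
have [->|p0] := eqVneq p 0; first by rewrite mul0r msize0.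
have [->|q0] := eqVneq q 0; first by rewrite mulr0 msize0.
move=> hp hq; rewrite msizeM //; apply: leq_trans (_ : (d.+1 + e.+1).-1 <= _)%N.
  by rewrite -!subn1 leq_sub2r // leq_add.
by rewrite addSn addnS.
Qed.

Lemma msize_exp p d e : (msize p <= d.+1)%N -> (msize (p ^+ e) <= (e * d).+1)%N.
Proof.
move=> hp; elim: e => [|e IH]; first by rewrite expr0 msize1.
by rewrite exprS mulSn; apply: msize_mul.
Qed.

Lemma mpoly_box_eq0 p d : (msize p <= d.+1)%N ->
  (forall e : {ffun 'I_n -> 'I_d.+1}, p@_[multinom (e i : nat) | i < n] = 0) -> p = 0.
Proof.
move=> /msize_leP h p0; apply/mpolyP => m; rewrite mcoeff0.
have [m_p|] := boolP (m \in msupp p); last exact: memN_msupp_eq0.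
have lt_d i : (m i < d.+1)%N.
  by apply: leq_trans (h m m_p); rewrite ltnS mdegE (bigD1 i) //= leq_addr.
rewrite -(p0 [ffun i => Ordinal (lt_d i)]); congr (_@__).
by apply/mnmP => i; rewrite mnmE ffunE.
Qed.

End Degrees.

Lemma eq_linear_msupp (k : fieldType) (n : nat) (V : lmodType k)
    (f g : {linear mpoly n k -> V}) p :
  {in msupp p, forall m, f 'X_[m] = g 'X_[m]} -> f p = g p.
Proof.
move=> fg; rewrite [p]mpolyE big_seq (linear_sum f) (linear_sum g).
by apply: eq_bigr => m m_p; rewrite !linearZ /= fg.
Qed.

Lemma msize_comp_vars (k : fieldType) (n N : nat) (f : 'I_n -> 'I_N) (p : mpoly n k) d :
  (msize p <= d)%N ->
  (msize (p \mPo [tuple 'X_(f i) : mpoly N k | i < n]) <= d)%N.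
Proof.
move=> /msize_leP h; rewrite comp_mpolyE big_seq.
apply: msize_bigsum => m /h le_d; apply: msize_scale; apply: leq_trans le_d.
have -> : mdeg m = (\sum_i m i * 1)%N by rewrite mdegE; apply: eq_bigr => i _; rewrite muln1.
elim: (index_enum _) => [|i s IH]; first by rewrite !big_nil msize1.
rewrite !big_cons; apply: msize_mul => //; apply: msize_exp.
by rewrite tnth_mktuple msizeX mdeg1.
Qed.

Section Separation.
Variables (k : fieldType) (n : nat).
Local Notation A := (mpoly n k).
Local Notation P := (mpoly (n + n) k).
Hypothesis char0 : [pchar k] =i pred0.

Lemma msize_inx (p : A) d : (msize p <= d)%N -> (msize (minx p) <= d)%N.
Proof. exact: msize_comp_vars. Qed.

Lemma msize_iny (p : A) d : (msize p <= d)%N -> (msize (miny p) <= d)%N.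
Proof. exact: msize_comp_vars. Qed.

Lemma msize_diag (g : P) d : (msize g <= d)%N -> (msize (mdiag g) <= d)%N.
Proof. exact: msize_comp_vars. Qed.

Lemma minx_mdiag (g : P) : (forall i, mdy i g = 0) -> minx (mdiag g) = g.
Proof.
move=> dg; apply: (eq_linear_msupp (f := minx \o mdiag) (g := idfun)) => m m_g /=.
have m0 i : m (rshift n i) = 0%N.
  apply/eqP; rewrite -leqn0 leqNgt; apply/negP => m_gt0.
  have := congr1 (mcoeff (m - U_(rshift n i))%MM) (dg i).
  rewrite /mdy mcoeff_mderiv mcoeff0 submK; last first.
    by apply/mnm_lepP => j; rewrite mnm1E; case: eqP => // <-.
  move/eqP; rewrite -mulr_natl mulf_eq0 mcoeff_eq0 m_g orbF.
  by rewrite (pcharf0P k).1.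
rewrite mpolyXE_id !rmorph_prod big_split_ord /= [RHS]big_split_ord /=; congr (_ * _).
  by apply: eq_bigr => i _; rewrite !rmorphXn /= mdiagX (unsplitK (inl i)) minxX.
by apply: eq_bigr => i _; rewrite m0 !expr0 !rmorph1.
Qed.

Definition mcat (m m' : 'X_{1..n}) : 'X_{1..n + n} :=
  [multinom match split i with inl j => m j | inr j => m' j end | i < n + n].

Lemma mcat_inj m1 m2 m1' m2' :
  (mcat m1 m1' == mcat m2 m2') = (m1 == m2) && (m1' == m2').
Proof.
apply/eqP/andP => [h|[/eqP -> /eqP ->]] //.
split; apply/eqP/mnmP => i.
  by move/mnmP/(_ (lshift n i)): h; rewrite !mnmE (unsplitK (inl i)).
by move/mnmP/(_ (rshift n i)): h; rewrite !mnmE (unsplitK (inr i)).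
Qed.

Lemma inx_iny_X m m' : minx 'X_[m] * miny 'X_[m'] = 'X_[mcat m m'] :> P.
Proof.
rewrite /minx /miny !comp_mpolyX [RHS]mpolyXE_id big_split_ord /=.
by congr (_ * _); apply: eq_bigr => i _;
  rewrite tnth_mktuple mnmE ?(unsplitK (inl i)) ?(unsplitK (inr i)).
Qed.

Lemma mcoeff_inx_iny (p q : A) m m' :
  (minx p * miny q)@_(mcat m m') = p@_m * q@_m'.
Proof.
have E (f : A) u : f@_u = \sum_(v <- msupp f) f@_v * (v == u)%:R.
  by rewrite {1}[f]mpolyE raddf_sum /=; apply: eq_bigr => v _; rewrite mcoeffZ mcoeffX.
have L (F : {linear A -> P}) f : F f = \sum_(v <- msupp f) f@_v *: F 'X_[v].
  by rewrite {1}[f]mpolyE linear_sum /=; apply: eq_bigr => v _; rewrite linearZ.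
rewrite (E p) (E q) (L minx p) (L miny q) !big_distrlr raddf_sum /=.
apply: eq_bigr => v _; rewrite raddf_sum /=; apply: eq_bigr => w _.
rewrite -scalerAl -scalerAr scalerA inx_iny_X mcoeffZ mcoeffX mcat_inj.
by rewrite mulrACA -natrM mulnb.
Qed.

End Separation.

Lemma mpoly_domain (k : fieldType) (n : nat) (a b : mpoly n k) :
  a * b = 0 -> a = 0 \/ b = 0.
Proof. by move/eqP; rewrite mulf_eq0 => /orP[] /eqP; [left | right]. Qed.

Definition mp_two_point (k : fieldType) (n : nat) : two_point k n :=
  @TwoPoint k n (mpoly n k) (mpoly (n + n) k) (fun i => mderiv i) mdx mdy minx miny mdiag
  (fun i => 'X_i) (@mpoly_domain _ _)
  (@mderivM _ _) (@mderivXU _ _) (@mdxM _ _) (@mdyM _ _) (@mdxC _ _) (@mdyC _ _) (@mdxyC _ _)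
  (@mdx_inx _ _) (@mdy_iny _ _) (@mdx_iny _ _) (@mdy_inx _ _) (@mdiag_inx _ _) (@mdiag_iny _ _)
  (@mdiag_dxdy _ _).

Section Concrete.
Variables (k : fieldType) (n : nat).
Hypothesis char0 : [pchar k] =i pred0.
Local Notation D := (mp_two_point k n).
Local Notation A := (mpoly n k).
Local Notation P := (mpoly (n + n) k).
Local Notation W := {ffun 'I_n -> tpA D}.
Local Notation T := {ffun 'I_n * 'I_n -> tpP D}.

Lemma vanish_eq0 r (g : tpP D) : vanish r g -> (msize (g : P) <= r)%N -> g = 0.
Proof.
elim: r g => [|r IH] g vg; first by rewrite leqn0 msize_poly_eq0 => /eqP.
move=> sg; rewrite -[g](minx_mdiag char0) => [|i].
  by rewrite -[mdiag g]/(diag (g : tpP D)) (vanish_diag vg); apply: (raddf0 minx).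
by apply: IH; [apply: (vanish_dy i vg) | apply: msize_mderiv].
Qed.

Definition dyw (s : seq 'I_n) (g : tpP D) : tpP D := foldr (fun i h => dy i h) g s.

Lemma vanish_dyw r (g : tpP D) :
  (forall s, (size s < r)%N -> diag (dyw s g) = 0) -> vanish r g.
Proof.
elim: r g => [//|r IH] g h; split; first exact: (h [::]).
move=> i; apply: IH => s s_r; have := h (rcons s i).
by rewrite size_rcons /dyw foldr_rcons; apply.
Qed.

Lemma dyw_linear s : linear (dyw s).
Proof. by rewrite /dyw => c g h; elim: s => //= i s ->; rewrite linearP. Qed.

Lemma msize_dyw s (g : tpP D) d : (msize (g : P) <= d)%N -> (msize (dyw s g : P) <= d)%N.
Proof.
move=> hg; elim: s => [//|i s IH].
by apply: (@msize_mderiv _ _ (dyw s g : P) (rshift n i)); apply: leqW.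
Qed.

Lemma msize_symtens (X Y : W) p d :
  (forall i, msize (X i : A) <= d.+1)%N -> (forall i, msize (Y i : A) <= d.+1)%N ->
  (msize (symtens X Y p : P) <= (d + d).+1)%N.
Proof.
move=> hX hY; rewrite symtensE.
exact: (msize_add (msize_mul (msize_inx (hX p.1)) (msize_iny (hY p.2)))
                  (msize_mul (msize_inx (hY p.1)) (msize_iny (hX p.2)))).
Qed.

Lemma symtens_free h (a b : 'I_h -> W) (c : 'I_h -> 'I_h -> k) :
  (forall ga de : 'I_h -> k, \sum_i ga i *: a i + \sum_i de i *: b i = 0 ->
     (forall i, ga i = 0) /\ (forall i, de i = 0)) ->
  \sum_i \sum_j c i j *: symtens (a i) (b j) = 0 -> forall i j, c i j = 0.
Proof.
move=> free c0.
have E p q m m' : \sum_i (\sum_j c i j * mcoeff m' (b j q)) * mcoeff m (a i p)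
     + \sum_j (\sum_i c i j * mcoeff m' (a i q)) * mcoeff m (b j p) = 0.
  have := congr1 (fun t : T => mcoeff (mcat m m') (t (p, q) : P)) c0.
  rewrite ffunE mcoeff0 sum_ffunE raddf_sum /= => h0; rewrite -[RHS]h0 {h0}.
  have -> : \sum_j (\sum_i c i j * mcoeff m' (a i q)) * mcoeff m (b j p)
      = \sum_i \sum_j c i j * mcoeff m' (a i q) * mcoeff m (b j p).
    by rewrite exchange_big; apply: eq_bigr => j _; rewrite mulr_suml.
  rewrite -big_split; apply: eq_bigr => i _ /=.
  rewrite mulr_suml -big_split sum_ffunE raddf_sum; apply: eq_bigr => j _ /=.
  have -> : (c i j *: symtens (a i) (b j) : T) (p, q) =
      c i j *: (minx (a i p) * miny (b j q) + minx (b j p) * miny (a i q)) :> P.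
    by rewrite -[RHS]/(c i j *: (inx (a i p) * iny (b j q) + inx (b j p) * iny (a i q) : tpP D))
         -(symtensE (a i) (b j) (p, q)) ffunE.
  rewrite mcoeffZ mcoeffD !mcoeff_inx_iny; ring.
have F q m' i : \sum_j c i j * mcoeff m' (b j q) = 0.
  have [|h0 _] := free (fun i => \sum_j c i j * mcoeff m' (b j q))
    (fun j => \sum_i c i j * mcoeff m' (a i q)); last exact: h0.
  apply/ffunP => p; rewrite !ffunE !sum_ffunE; apply/mpolyP => m.
  rewrite mcoeff0 mcoeffD !raddf_sum /= -[RHS](E p q m m'); congr (_ + _);
  by apply: eq_bigr => l _; rewrite ffunE [LHS]mcoeffZ.
move=> i j; have [|_ d0] := free (fun=> 0) (c i); last exact: d0.
rewrite big1 ?add0r; last by move=> l _; rewrite scale0r.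
apply/ffunP => q; rewrite ffunE sum_ffunE; apply/mpolyP => m'.
rewrite mcoeff0 raddf_sum /= -[RHS](F q m' i).
by apply: eq_bigr => l _; rewrite ffunE [LHS]mcoeffZ.
Qed.

End Concrete.

Global Opaque minx miny mdiag mdx mdy.

(** * Counting *)

Lemma underdetermined (k : fieldType) (I J : finType) (f : I -> J -> k) :
  (#|J| < #|I|)%N ->
  exists2 c : I -> k, (exists i, c i != 0) & forall j, \sum_i c i * f i j = 0.
Proof.
move=> ltJI; pose M := \matrix_(i < #|I|, j < #|J|) f (enum_val i) (enum_val j).
have : kermx M != 0.
  rewrite kermx_eq0 /row_free; apply/eqP => rM.
  by have := rank_leq_col M; rewrite rM leqNgt ltJI.
case/rowV0Pn => u /sub_kermxP uM u0; exists (fun i => u 0 (enum_rank i)).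
  have [i ui] : exists i, u 0 i != 0.
    apply/existsP; apply: contraR u0; rewrite negb_exists => /forallP h.
    by apply/eqP/rowP => i; rewrite mxE; apply/eqP; have := h i; rewrite negbK.
  by exists (enum_val i); rewrite enum_valK.
move=> j; have := congr1 (fun N : 'rV_#|J| => N 0 (enum_rank j)) uM.
rewrite !mxE => h0; rewrite -[RHS]h0 (reindex (@enum_val I predT)) /=; last first.
  by exists enum_rank => i _; [apply: enum_valK | apply: enum_rankK].
by apply: eq_bigr => i _; rewrite mxE enum_valK enum_rankK.
Qed.

Lemma functional_sum (k : fieldType) (V : lmodType k) (G : V -> k) (I : finType)
    (c : I -> k) (F : I -> V) :
  (forall a u v, G (a *: u + v) = a * G u + G v) ->
  G (\sum_i c i *: F i) = \sum_i c i * G (F i).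
Proof.
move=> GP; have G0 : G 0 = 0.
  by have := GP (-1) 0 0; rewrite scaler0 addr0 mulN1r addNr.
elim: (index_enum I) => [|i s IH]; first by rewrite !big_nil.
by rewrite !big_cons GP IH.
Qed.

Section Annihilator.
Variables (k : fieldType) (n : nat) (D : two_point k n).
Local Notation W := {ffun 'I_n -> tpA D}.
Local Notation T := {ffun 'I_n * 'I_n -> tpP D}.
Variable L : W -> Prop.
Hypothesis L0 : L 0.
Hypothesis LP : forall (a : k) X Y, L X -> L Y -> L (a *: X + Y).
Hypothesis Lbr : forall X Y, L X -> L Y -> L (wbr X Y).
Hypothesis Linf : forall m, exists X : 'I_m -> W, (forall i, L (X i)) /\
  forall c : 'I_m -> k, \sum_i c i *: X i = 0 -> forall i, c i = 0.
Variables (r e : nat) (sg : nat -> seq T).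
Hypothesis sgL : forall j i, symL L (sg j)`_i /\ vanT (r + j) (sg j)`_i.
Hypothesis sg_span : forall j t, symL L t -> vanT (r + j) t ->
  exists c : nat -> k, vanT (r + j).+1 (t - \sum_(i < size (sg j)) c i *: (sg j)`_i).

Lemma exists_annihilator : exists Z, [/\ L Z, Z != 0 &
  forall s t, (r <= s < r + e)%N -> symL L t -> vanT s t -> vanT s.+1 (rho Z t)].
Proof.
pose N := (\max_(j < e) size (sg j))%N; pose m := (e * (N * N)).+1.
have [X [LX Xfree]] := Linf m.
have aP' (x : 'I_m * nat * nat) : exists ax : nat -> k,
    vanT (r + x.1.2).+1 (rho (X x.1.1) (sg x.1.2)`_x.2
      - \sum_(i < size (sg x.1.2)) ax i *: (sg x.1.2)`_i).
  have [Ls vs] := sgL x.1.2 x.2.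
  by apply: sg_span; [apply: symL_rho | apply: rho_vanT].
have [a aP] := choice aP'.
have card_lt : (#|{: 'I_e * ('I_N * 'I_N)}| < #|'I_m|)%N.
  by rewrite !card_prod !card_ord.
have [c [i0 ci0] cE] := underdetermined
  (fun (i : 'I_m) (x : 'I_e * ('I_N * 'I_N)) =>
    a (i, x.1 : nat, x.2.1 : nat) x.2.2) card_lt.
exists (\sum_i c i *: X i); split.
- apply: big_ind => // [x y Lx Ly|i _]; first by rewrite -[x]scale1r; apply: LP.
  by rewrite -[_ *: _]addr0; apply: LP.
- by apply/eqP => /Xfree /(_ i0) /eqP; rewrite (negbTE ci0).
have rhoZ' t : rho (\sum_i c i *: X i) t = \sum_i c i *: rho (X i) t.
  apply: (big_rec2 (fun Z u => rho Z t = u)) => [|i Z u _ <-]; last exact: rhoPl.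
  by have /eqP := rhoPl 1 0 0 t; rewrite !scale1r addr0 -subr_eq0 opprD addNKr oppr_eq0 => /eqP.
move=> s t /andP[r_s s_e] Lt vt.
have [j s_j] : exists j : 'I_e, s = (r + j)%N.
  have lt_e : (s - r < e)%N by rewrite ltn_subLR.
  by exists (Ordinal lt_e); rewrite /= subnKC.
rewrite s_j in vt *; have [b bP] := sg_span Lt vt.
rewrite -[t](subrK (\sum_(i < size (sg j)) b i *: (sg j)`_i)) linearD /=.
apply: vanTD; first exact: rho_vanT.
rewrite linear_sum /=; apply: vanT_sum => l _; rewrite linearZ /=; apply: vanTZ.
have N_ge : (size (sg j) <= N)%N by apply: (leq_bigmax j).
rewrite rhoZ' -[\sum_i _](subrK (\sum_i c i *:
  \sum_(l' < size (sg j)) a (i, j : nat, l : nat) l' *: (sg j)`_l')).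
apply: vanTD.
  rewrite -sumrB; apply: vanT_sum => i _; rewrite -scalerBr; apply: vanTZ.
  exact: (aP (i, j : nat, l : nat)).
under eq_bigr do rewrite scaler_sumr.
rewrite exchange_big /= big1; first exact: vanT0.
move=> l' _; under eq_bigr do rewrite scalerA.
rewrite -scaler_suml.
have := cE (j, (widen_ord N_ge l, widen_ord N_ge l')) => /= ->.
exact: scale0r.
Qed.

End Annihilator.

Section Counting.
Variables (k : fieldType) (n : nat).
Hypothesis char0 : [pchar k] =i pred0.
Local Notation D := (mp_two_point k n).
Local Notation A := (mpoly n k).
Local Notation P := (mpoly (n + n) k).
Local Notation W := {ffun 'I_n -> tpA D}.
Local Notation T := {ffun 'I_n * 'I_n -> tpP D}.
Variables (L : W -> Prop) (r : nat).
Hypothesis LZ : forall (a : k) X, L X -> L (a *: X).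
Hypothesis annih : forall e, exists Z, [/\ L Z, Z != 0 &
  forall s t, (r <= s < r + e)%N -> symL L t -> vanT s t -> vanT s.+1 (rho Z t)].

Lemma symL_count d h (a b : 'I_h -> W) :
  (forall i, L (a i)) -> (forall i, L (b i)) ->
  (forall i j, msize (a i j : A) <= d.+1)%N -> (forall i j, msize (b i j : A) <= d.+1)%N ->
  (forall ga de : 'I_h -> k, \sum_i ga i *: a i + \sum_i de i *: b i = 0 ->
     (forall i, ga i = 0) /\ (forall i, de i = 0)) ->
  (d.+1 * (h * h) <= d.+1 * n.+1 ^ r * (n * n) * (d + d).+1 ^ n
                     + n * n * (d + (d + d)).+1 ^ (n + n))%N.
Proof.
move=> La Lb da db free; rewrite leqNgt; apply/negP => lt_card.
have [Z [LZ' Z0 Zann]] := annih (d + d).+1.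
have [p Zp] : exists p, Z p != 0.
  apply/existsP; apply: contraR Z0; rewrite negb_exists => /forallP h0.
  by apply/eqP/ffunP => i; rewrite ffunE; apply/eqP; have := h0 i; rewrite negbK.
pose x : tpA D := 'X_p : A.
have app_x : app Z x != 0.
  rewrite /app (bigD1 p) //= big1 ?addr0 => [|i /negbTE ip].
    by rewrite (pdX D p p) eqxx mulr1.
  by rewrite (pdX D i p) ip mulr0.
pose S i j : T := symtens (a i) (b j).
pose unk := ('I_d.+1 * ('I_h * 'I_h))%type.
(* [eq1] expresses that each [u e] below vanishes to order [r]: a word in the derivations [dy],
   padded with [None], is applied before restricting to the diagonal.  [eq2] expresses
   [\sum_e x ^+ e * u e = 0]. *)
pose eq1 := ('I_d.+1 * r.-tuple (option 'I_n) * ('I_n * 'I_n) * {ffun 'I_n -> 'I_(d + d).+1})%type.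
pose eq2 := (('I_n * 'I_n) * {ffun 'I_(n + n) -> 'I_(d + (d + d)).+1})%type.
pose wd (w : r.-tuple (option 'I_n)) := pmap id w.
pose mon N d (m : {ffun 'I_N -> 'I_d.+1}) : 'X_{1..N} := [multinom (m i : nat) | i < N].
pose f (u : unk) (y : eq1 + eq2) : k := match y with
  | inl q => (u.1 == q.1.1.1)%:R *
     mcoeff (mon _ _ q.2) (diag (dyw (wd q.1.1.2) (S u.2.1 u.2.2 q.1.2)) : A)
  | inr q => mcoeff (mon _ _ q.2) (scal (x ^+ u.1) (S u.2.1 u.2.2) q.1 : P)
  end.
have card_lt : (#|{: eq1 + eq2}| < #|{: unk}|)%N.
  rewrite card_sum !card_prod !card_ffun !card_ord card_tuple card_option card_ord.
  by rewrite !mulnA in lt_card *.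
have [c [[e0 [i0 j0]] c_neq0] cE] := underdetermined f card_lt.
pose u (e : nat) : T := \sum_(ij : 'I_h * 'I_h) c (inord e, ij) *: S ij.1 ij.2.
have La_S i j : symL L (S i j) by apply: symL_tens.
have symL_u e : symL L (u e) by apply: symL_sum => ij _; apply: symLZ.
have msize_S i j q : (msize (S i j q : P) <= (d + d).+1)%N by apply: msize_symtens.
have uE e q : u e q = \sum_(ij : 'I_h * 'I_h) c (inord e, ij) *: S ij.1 ij.2 q.
  by rewrite sum_ffunE; apply: eq_bigr => ij _; rewrite ffunE.
have msize_u e q : (msize (u e q : P) <= (d + d).+1)%N.
  by rewrite uE; apply: msize_bigsum => ij _; apply: msize_scale; apply: msize_S.
have unkE (F : unk -> k) : \sum_y F y = \sum_e1 \sum_ij F (e1, ij).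
  by rewrite pair_bigA; apply: eq_bigr => -[].
have u_van e : vanT r (u e).
  move=> q; apply: vanish_dyw => s s_r.
  have [w <-] : exists w, wd w = s.
    have sz : size (map Some s ++ nseq (r - size s) None) == r.
      by rewrite size_cat size_map size_nseq subnKC // ltnW.
    exists (Tuple sz); rewrite /wd /= pmap_cat.
    have -> : pmap id (nseq (r - size s) (None : option 'I_n)) = [::] by elim: (r - size s)%N.
    by rewrite cats0; elim: (s) => //= i s' ->.
  apply: (@mpoly_box_eq0 _ _ _ (d + d)).
    by apply: msize_diag; apply: msize_dyw; apply: msize_u.
  move=> m; have := cE (inl (inord e, w, q, m)).
  rewrite unkE (bigD1 (inord e)) //= [X in _ + X]big1 ?addr0 => [h0|e1 /negbTE ne]; last first.
    by rewrite big1 // => ij _; rewrite ne mul0r mulr0.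
  rewrite uE (functional_sum _ _ (G := fun g : tpP D => mcoeff _ (diag (dyw (wd w) g) : A))).
    by rewrite -[RHS]h0; apply: eq_bigr => ij _ /=; rewrite eqxx mul1r.
  by move=> b1 g1 g2; rewrite dyw_linear !linearP.
have u_sum : \sum_(e < d.+1) scal (x ^+ e) (u e) = 0.
  apply/ffunP => q; rewrite sum_ffunE ffunE.
  apply: (@mpoly_box_eq0 _ _ _ (d + (d + d))) => [|m].
    apply: msize_bigsum => e _; rewrite ffunE.
    apply: msize_mul; last exact: msize_u.
    apply: msize_inx; apply: (@leq_trans (e * 1).+1).
      by apply: msize_exp; rewrite msizeX mdeg1.
    by rewrite muln1 ltnS -ltnS.
  transitivity (\sum_(e < d.+1) mcoeff (mon (n + n)%N _ m) (inx (x ^+ e) * u e q : P)).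
    by rewrite -raddf_sum; congr mcoeff; apply: eq_bigr => e _; rewrite ffunE.
  rewrite -[RHS](cE (inr (q, m))) unkE; apply: eq_bigr => e _; rewrite uE inord_val.
  rewrite (functional_sum _ _ (G := fun g : tpP D => mcoeff _ (inx (x ^+ e) * g : P))).
    apply: eq_bigr => ij _; congr (_ * _); rewrite /f /=; congr (mcoeff _ _).
    exact/esym/ffunE.
  by move=> b1 g1 g2; rewrite mulrDr -scalerAr [LHS]mcoeffD mcoeffZ.
have u0 : u e0 = 0.
  apply/ffunP => q; rewrite ffunE; apply: (vanish_eq0 char0) (msize_u e0 q).
  apply: (@vanish_le _ _ _ (r + (d + d).+1)); first exact: leq_addl.
  exact: (vanT_descent char0 app_x Zann symL_u u_van u_sum (ltn_ord e0)).
have /eqP := c_neq0; apply.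
apply: (symtens_free (c := fun i j => c (e0, (i, j))) free).
rewrite pair_bigA /= -[RHS]u0; apply: eq_bigr => -[i j] _ /=.
by rewrite inord_val.
Qed.

End Counting.

Local Close Scope ring_scope.
Lemma count_arith K N d n h : 0 < n ->
  d.+1 * (h * h) <= d.+1 * K * N * (d + d).+1 ^ n + N * (d + (d + d)).+1 ^ (n + n) ->
  h * h <= (K * N * 2 ^ n + N * 9 ^ n) * d.+1 ^ (2 * n - 1).
Proof.
move=> n0 le; rewrite -(leq_pmul2l (ltn0Sn d)); apply: leq_trans le _.
rewrite [leqRHS]mulnCA -expnS; have -> : (2 * n - 1).+1 = n + n by lia.
have le2 : d.+1 * (d + d).+1 ^ n <= 2 ^ n * d.+1 ^ (n + n).
  apply: (@leq_trans (d.+1 * (2 * d.+1) ^ n)).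
    by rewrite leq_mul2l /= leq_exp2r //; lia.
  by rewrite expnMn mulnCA -expnS leq_mul2l leq_pexp2l ?orbT //; lia.
have le3 : (d + (d + d)).+1 ^ (n + n) <= 9 ^ n * d.+1 ^ (n + n).
  apply: (@leq_trans ((3 * d.+1) ^ (n + n))); first by rewrite leq_exp2r; lia.
  by rewrite expnMn addnn -mul2n (expnM 3 2 n).
rewrite mulnDl; apply: leq_add.
  have -> : d.+1 * K * N * (d + d).+1 ^ n = K * N * (d.+1 * (d + d).+1 ^ n) by lia.
  by rewrite -[leqRHS]mulnA leq_mul2l le2 orbT.
by rewrite -mulnA leq_mul2l le3 orbT.
Qed.

Lemma half_square_bound M s h : s = h + h \/ s = (h + h).+1 -> h * h <= M -> 0 < M ->
   s ^ 2 <= 9 * M.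
Proof. by move=> [] -> *; rewrite expnS expn1; nia. Qed.
Local Open Scope ring_scope.

Section Enveloping.
Variables (k : fieldType) (n : nat) (L : {pred Witt k n}).
Hypothesis char0 : [pchar k] =i pred0.
Hypothesis n_gt0 : (0 < n)%N.
Hypothesis LieL : is_Lie_subalgebra L.
Hypothesis noethL : quot_right_noetherian (@UL_ideal k n L).
Local Notation D := (mp_two_point k n).
Local Notation FA := (@freeAlg k n L).
Local Notation T := {ffun 'I_n * 'I_n -> tpP D}.

Definition evL (x : Lelt L) : {ffun 'I_n -> tpA D} := val x.

Lemma UL_ideal_act (w : FA) : UL_ideal w -> forall g : T, act (rhoK evL) w g = 0.
Proof.
move=> [m [c [x [Jx ->]]]] g.
have lE (y : Lelt L) (h : T) : act (rhoK evL) (letter y) h = rho (evL y) h.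
  exact: act_letter.
have xa i : act (rhoK evL) (x i) g = 0.
  have [a [r [b [rel ->]]]] := Jx i; rewrite !actM.
  suff -> : act (rhoK evL) r (act (rhoK evL) b g) = 0 by rewrite linear0.
  move: (act _ b g) => h {x Jx a b}.
  case: rel => [[a [y [z [t [tE ->]]]]]|[y [z [t [tE ->]]]]].
    rewrite act_combination 3!lE.
    by rewrite /evL tE (rhoPl a (val y : {ffun 'I_n -> tpA D}) (val z)) subrr.
  rewrite act_commutator 5!lE.
  by rewrite /evL tE (rho_wbr (val y : {ffun 'I_n -> tpA D}) (val z)) subrr.
rewrite act_sum big1 // => i _.
by rewrite actZ xa scaler0.
Qed.

Lemma UL_noetherian_chain (I : nat -> FA -> Prop) :
  (forall m, [/\ I m 0, forall w u, I m w -> I m u -> I m (w + u),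
     forall a w, I m w -> I m (w * a), forall w, UL_ideal w -> I m w &
     forall w, I m w -> I m.+1 w]) ->
  exists N, forall m, (N <= m)%N -> forall w, I m w -> I N w.
Proof.
move=> IP; have [m|N NP] := noethL (I := I).
  by have [I0 ID IM IJ IS] := IP m; split; [split | split].
by exists N => m le_Nm w; rewrite (NP m le_Nm).
Qed.

Lemma Limg_evL X : Limg evL X <-> X \in L.
Proof. by split=> [[x <-]|LX]; [apply: valP | exists (exist _ X LX)]. Qed.

Definition indep m (X : 'I_m -> Witt k n) :=
  forall c : 'I_m -> k, \sum_i c i *: X i = 0 -> forall i, c i = 0.

Lemma indep_bound : (forall m, exists X : 'I_m -> Witt k n, (forall i, X i \in L) /\ indep X) ->
  exists C, forall d h (a b : 'I_h -> Witt k n),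
  (forall i, a i \in L) -> (forall i, b i \in L) ->
  (forall i j, msize (a i j) <= d.+1)%N -> (forall i j, msize (b i j) <= d.+1)%N ->
  (forall ga de : 'I_h -> k, \sum_i ga i *: a i + \sum_i de i *: b i = 0 ->
     (forall i, ga i = 0) /\ (forall i, de i = 0)) ->
  (h * h <= C * d.+1 ^ (2 * n - 1))%N.
Proof.
move=> Linf; have [L0 LD LZ Lbr] := LieL.
pose Lp (X : {ffun 'I_n -> tpA D}) := X \in L.
pose r := (2 * n + 2).+3.
have fin j : exists s : seq T, (forall i, symL (Limg evL) s`_i /\ vanT (r + j) s`_i) /\
    forall t, symL (Limg evL) t -> vanT (r + j) t ->
      exists c : nat -> k, vanT (r + j).+1 (t - \sum_(i < size s) c i *: s`_i).
  apply: (sym_quotient_finite (q := (2 * n + 2 + j)%N) char0 (leq_addr _ _)) UL_ideal_act _.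
  exact: UL_noetherian_chain.
have [sg sgP] := choice fin.
have annih e : exists Z, [/\ Limg evL Z, Z != 0 & forall s t, (r <= s < r + e)%N ->
    symL (Limg evL) t -> vanT s t -> vanT s.+1 (rho Z t)].
  apply: (@exists_annihilator k n D (Limg evL) _ _ _ _ r e sg).
  - exact/Limg_evL.
  - by move=> a X Y /Limg_evL LX /Limg_evL LY; apply/Limg_evL/LD => //; apply: LZ.
  - by move=> X Y /Limg_evL LX /Limg_evL LY; apply/Limg_evL; apply: Lbr.
  - move=> m; have [X [LX Xfree]] := Linf m; exists X; split=> // i.
    exact/Limg_evL.
  - by move=> j i; apply: (sgP j).1.
  by move=> j; apply: (sgP j).2.
exists (n.+1 ^ r * (n * n) * 2 ^ n + n * n * 9 ^ n)%N => d h a b La Lb da db free.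
have LimgZ (c : k) (X : {ffun 'I_n -> tpA D}) : Limg evL X -> Limg evL (c *: X).
  by move=> /Limg_evL LX; apply/Limg_evL/LZ.
have cnt := symL_count char0 LimgZ annih (fun i => (Limg_evL _).2 (La i))
  (fun i => (Limg_evL _).2 (Lb i)) da db free.
exact: count_arith cnt.
Qed.

Lemma lin_indep_prefix m (s : seq (Witt k n)) (c : 'I_m -> k) :
  (m <= size s)%N -> lin_indep s -> \sum_i c i *: s`_i = 0 -> forall i, c i = 0.
Proof.
move=> le_m sfree c0 i; pose c' (i : nat) := if insub i is Some j then c j else 0.
have : \sum_(i < size s) c' i *: s`_i = 0.
  rewrite -[RHS]c0 -(big_mkord xpredT (fun i => c' i *: s`_i)).
  rewrite (big_cat_nat (leq0n m) le_m) /= [X in _ + X]big_nat_cond [X in _ + X]big1 ?addr0.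
    by rewrite big_mkord; apply: eq_bigr => j _; rewrite /c' valK.
  move=> j /andP[/andP[le_j _] _]; rewrite /c' insubF ?scale0r //.
  by apply/negbTE; rewrite -leqNgt.
by move=> /sfree/(_ (widen_ord le_m i)); rewrite /c' /= valK.
Qed.

Lemma lin_indep_count : exists C, forall d (s : seq (Witt k n)),
  (forall x, x \in s -> x \in L /\ forall i, (msize (x i) <= d)%N) ->
  lin_indep s -> (size s ^ 2 <= C * d.+1 ^ (2 * n - 1))%N.
Proof.
have [Linf|] := pselect (forall m, exists X : 'I_m -> Witt k n, (forall i, X i \in L) /\ indep X).
  have [C HC] := indep_bound Linf.
  exists (9 * C.+1)%N => d s sL sfree; pose h := (size s)./2.
  have szh : (h + h <= size s)%N by rewrite addnn /h -[X in (_ <= X)%N]odd_double_half leq_addl.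
  have mem (i : nat) : (i < h + h)%N -> s`_i \in L /\ forall j, (msize (s`_i j) <= d)%N.
    by move=> i_h; apply: sL; apply: mem_nth; apply: leq_trans szh.
  have ma (i : 'I_h) := mem _ (ltn_ord (lshift h i)).
  have mb (i : 'I_h) := mem _ (ltn_ord (rshift h i)).
  have hh := HC d h (fun i => s`_i) (fun j => s`_(h + j))
    (fun i => (ma i).1) (fun i => (mb i).1)
    (fun i j => leqW ((ma i).2 j)) (fun i j => leqW ((mb i).2 j)).
  have {}hh : (h * h <= C * d.+1 ^ (2 * n - 1))%N.
    apply: hh => ga de.
    pose c (i : 'I_(h + h)) := match split i with inl j => ga j | inr j => de j end.
    move=> gd0; have c0 : \sum_i c i *: s`_i = 0.
      rewrite big_split_ord /= -[RHS]gd0; congr (_ + _); apply: eq_bigr => i _.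
        by rewrite /c (unsplitK (inl i)).
      by rewrite /c (unsplitK (inr i)).
    split=> i; [have := lin_indep_prefix szh sfree c0 (lshift h i) |
                have := lin_indep_prefix szh sfree c0 (rshift h i)];
      by rewrite /c ?(unsplitK (inl i)) ?(unsplitK (inr i)).
  rewrite -mulnA; apply: (half_square_bound (h := h)).
  - rewrite -[size s]odd_double_half -/h -addnn; case: (odd _); [right | left] => //.
  - by apply: leq_trans hh _; rewrite leq_mul2r leqnSn orbT.
  by rewrite muln_gt0 expn_gt0.
move=> /existsNP[m nX]; exists (m ^ 2)%N => d s sL sfree.
rewrite (leq_trans _ (leq_pmulr _ _)) ?expn_gt0 // leq_exp2r // leqNgt; apply/negP => lt_m.
apply: nX; exists (fun i => s`_i); split=> [i|c c0 i].
  by apply: (sL _ _).1; apply: mem_nth; apply: leq_trans lt_m; apply: leqW.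
exact: (lin_indep_prefix (ltnW lt_m) sfree c0).
Qed.

End Enveloping.

(** * Growth *)

From mathcomp Require Import all_classical all_reals all_analysis.

Local Open Scope classical_set_scope.

Section Growth.
Variables (k : fieldType) (n : nat) (L : {pred Witt k n}).
Hypothesis LieL : is_Lie_subalgebra L.

Definition deg_le d (X : Witt k n) := forall i, (msize (X i) <= d.+1)%N.

Lemma deg_le_trans d e X : (d <= e)%N -> deg_le d X -> deg_le e X.
Proof. by move=> de hX i; apply: leq_trans (hX i) _. Qed.

Lemma span_deg_le d (A : set (Witt k n)) : (forall x, A x -> x \in L /\ deg_le d x) ->
  forall x, Defs.span A x -> x \in L /\ deg_le d x.
Proof.
have [L0 LD LZ _] := LieL.
move=> hA x [m [c [y [Ay ->]]]]; elim: m c y Ay => [|m IH] c y Ay.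
  by rewrite big_ord0; split=> // i; rewrite ffunE msize0.
rewrite big_ord_recl; have [Ly dy] := hA _ (Ay ord0).
have [|Lz dz] := IH (fun i => c (lift ord0 i)) (fun i => y (lift ord0 i)).
  by move=> i; apply: Ay.
split; first by apply: LD => //; apply: LZ.
move=> i; rewrite !ffunE; apply: msize_add; first by apply: msize_scale; apply: dy.
exact: dz.
Qed.

Lemma wbracket_deg_le d e X Y : deg_le d X -> deg_le e Y -> deg_le (d + e) (wbracket X Y).
Proof.
move=> dX dY j; rewrite ffunE; apply: msize_bigsum => i _.
apply: msize_add; last first.
  by apply: msize_opp; rewrite addnC; apply: msize_mul => //; apply: msize_mderiv; apply: leqW.
by apply: msize_mul => //; apply: msize_mderiv; apply: leqW.
Qed.

Section Generators.
Variables (vs : seq (Witt k n)) (d : nat).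
Hypothesis vsL : forall x, x \in vs -> x \in L /\ deg_le d x.

Lemma Cspace_deg_le j x : Cspace (@wbracket k n) vs j x -> x \in L /\ deg_le (j.+1 * d) x.
Proof.
have [_ _ _ Lbr] := LieL.
elim: j x => [|j IH] x /=; first by rewrite mul1n; apply: span_deg_le.
apply: span_deg_le => z [y /IH[Ly dy] [t /(span_deg_le vsL)[Lt dt] <-]].
split; first exact: Lbr.
by rewrite mulSn addnC; apply: wbracket_deg_le.
Qed.

Lemma Gspace_deg_le j x : Gspace (@wbracket k n) vs j x -> x \in L /\ deg_le (j.+1 * d) x.
Proof.
apply: span_deg_le => z [i [ij /Cspace_deg_le[Lz dz]]]; split=> //.
by apply: deg_le_trans dz; rewrite leq_mul2r ltnS ij orbT.
Qed.

End Generators.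

Variables (R : realType) (C : nat).
Hypothesis n_gt0 : (0 < n)%N.
Hypothesis countL : forall d (s : seq (Witt k n)),
  (forall x, x \in s -> x \in L /\ forall i, (msize (x i) <= d)%N) ->
  lin_indep s -> (size s ^ 2 <= C * d.+1 ^ (2 * n - 1))%N.

Lemma dimE_Gspace_bound (vs : seq (Witt k n)) : (forall x, x \in vs -> x \in L) ->
  exists2 B : nat, (0 < B)%N & forall j, (0 < j)%N ->
    exists2 x : R, dimE R (Gspace (@wbracket k n) vs j) = x%:E &
      0 <= x /\ x ^+ 2 <= B%:R * j%:R ^+ (2 * n - 1).
Proof.
move=> vsL; pose d := (\max_(x <- vs) \max_(i < n) msize (x i))%N.
have vs_deg x : x \in vs -> x \in L /\ deg_le d x.
  move=> x_vs; split=> [|i]; first exact: vsL.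
  by apply: leqW; rewrite /d (big_rem x) //= leq_max (leq_bigmax i).
exists (C.+1 * (2 * d.+2) ^ (2 * n - 1))%N; first by rewrite muln_gt0 expn_gt0.
move=> j j0; set S := Gspace _ _ _; set B := (_ * _)%N.
have bnd s : (forall x, x \in s -> S x) -> lin_indep s ->
    ((size s)%:R : R) ^+ 2 <= B%:R * j%:R ^+ (2 * n - 1).
  move=> sS si; rewrite -!natrX -natrM ler_nat.
  apply: (@leq_trans (C * (j.+1 * d).+2 ^ (2 * n - 1))).
    apply: countL => // x /sS/(Gspace_deg_le vs_deg)[Lx dx]; split=> // i.
  rewrite /B -mulnA -expnMn; apply: leq_mul => //.
  rewrite leq_exp2r; last by lia.
  nia.
have Bj0 : 0 <= B%:R * j%:R ^+ (2 * n - 1) :> R by rewrite mulr_ge0 ?exprn_ge0.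
pose b : R := Num.sqrt (B%:R * j%:R ^+ (2 * n - 1)).
have b2 : b ^+ 2 = B%:R * j%:R ^+ (2 * n - 1) by rewrite sqr_sqrtr.
have le_b : (dimE R S <= b%:E)%E.
  apply: ge_ereal_sup => _ [s [sS si] <-]; rewrite lee_fin.
  by rewrite -(ler_pXn2r (n := 2)) ?nnegrE ?sqrtr_ge0 // b2; apply: bnd.
have ge0 : (0%:E <= dimE R S)%E.
  apply: ereal_sup_ubound; exists [::] => //; split=> // c _ [].
  by [].
have fin : dimE R S \is a fin_num.
  by rewrite fin_numE; apply/andP; split; apply/eqP => E; rewrite E in le_b ge0.
exists (fine (dimE R S)); first by rewrite fineK.
rewrite -b2; rewrite -(fineK fin) !lee_fin in le_b ge0; split=> //.
by rewrite ler_pXn2r ?nnegrE ?sqrtr_ge0.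
Qed.

Lemma growth_rate_bound (vs : seq (Witt k n)) : (forall x, x \in vs -> x \in L) ->
  (growth_rate R (@wbracket k n) vs <= (n%:R - 4%:R^-1)%:E)%E.
Proof.
move=> /dimE_Gspace_bound[B B0 HB].
apply: (@le_trans _ _ (ereal_sup
   ((fun j => (growth_ratio R (@wbracket k n) vs j)%:E) @` [set j | (B ^ 2 + 2 <= j)%N]))).
  apply: ereal_inf_lbound; exists [set j | (B ^ 2 + 2 <= j)%N] => //.
  exact: nbhs_infty_ge.
apply: ge_ereal_sup => _ [j /= le_j <-]; rewrite lee_fin /growth_ratio.
have j2 : (2 <= j)%N by apply: leq_trans le_j; rewrite leq_addl.
have [x -> [x0 x2]] := HB j (ltnW j2); rewrite /=.
have j1R : 1 < j%:R :> R by rewrite ltr1n.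
have j0R : 0 < j%:R :> R by rewrite ltr0n ltnW.
have lnj : 0 < ln (j%:R : R) by apply: ln_gt0.
rewrite ler_pdivrMr //.
have n1 : 1 <= n%:R :> R by rewrite ler1n.
have [x1|x1] := leP x 1.
  by apply: (le_trans (ln_le0 x1)); rewrite mulr_ge0 // ?ltW //; lra.
have xp : 0 < x by apply: lt_trans x1.
have B0R : 0 < B%:R :> R by rewrite ltr0n.
have lnB : ln (B%:R : R) *+ 2 <= ln j%:R.
  rewrite -lnXn // ler_ln ?posrE ?exprn_gt0 // -natrX ler_nat.
  by apply: leq_trans le_j; rewrite leq_addr.
have : ln x *+ 2 <= ln (B%:R : R) + ln (j%:R : R) *+ (2 * n - 1).
  rewrite -!lnXn // -lnM ?posrE ?exprn_gt0 // ler_ln ?posrE ?mulr_gt0 ?exprn_gt0 //.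
have -> : ln (j%:R : R) *+ (2 * n - 1) = (2 * n%:R - 1) * ln j%:R.
  by rewrite -[LHS]mulr_natl natrB ?natrM // muln_gt0.
move: lnB; rewrite !mulrBl -mulrA mul1r !mulr2n.
move: (ln j%:R) (ln x) (ln B%:R) (n%:R * ln j%:R) => p q y z; lra.
Qed.

Lemma GKdim_bound :
  (GKdim R (@wbracket k n) [set x | x \in L] <= (n%:R - 4%:R^-1)%:E)%E.
Proof.
by apply: ge_ereal_sup => _ [vs vsL <-]; apply: growth_rate_bound.
Qed.

End Growth.

Theorem mainTheorem13 (R : realType) (k : fieldType) (n : nat)
    (L : {pred Witt k n}) :
  [pchar k]%R =i pred0 ->
  (1 <= n)%N ->
  is_Lie_subalgebra L ->
  GKdim R (@wbracket k n) [set x | x \in L] = ((n%:R : R)%:E)%E ->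
  ~ UL_noetherian L.
Proof.
move=> char0 n_gt0 LieL GKL [_ noethL].
have [C countL] := lin_indep_count char0 n_gt0 LieL noethL.
have := GKdim_bound LieL R n_gt0 countL.
by rewrite GKL lee_fin; lra.
Qed.
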